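(* Let $A_S$ be an irreducible spherical Artin group with Dynkin diagram $\Lambda$ and vertex set $S$, and let $\Lambda'\subset\Lambda$ be a linear subgraph. Then the relative Artin complex $\Delta_{\Lambda,\Lambda'}$ is bowtie free.
   Context: A Dynkin diagram is a finite simplicial graph $\Lambda$ with vertex set $S$ and edge labels integers $m\ge3$; $A_S$ has generators $S$ with $sts\cdots=tst\cdots$ (length $m$) for adjacent $s,t$ and $st=ts$ otherwise. Spherical: the Coxeter group (adding $s^2=1$) is finite; irreducible: $\Lambda$ connected (a connected spherical diagram is a tree). For $U\subset S$, $A_U$ is the subgroup generated by $U$, and $A_{\hat s}=A_{S\setminus\{s\}}$. The Artin complex $\Delta_\Lambda$ is the simplicial complex whose vertices are the left cosets $gA_{\hat s}$ ($g\in A_S$, $s\in S$), a finite set of vertices spanning a simplex iff the cosets have nonempty common intersection; the vertex $gA_{\hat s}$ has type $\hat s$. For an induced subgraph $\Lambda'$, the relative Artin complex $\Delta_{\Lambda,\Lambda'}$ is the induced subcomplex spanned by vertices of type $\hat s$ with $s\in\Lambda'$. A linear subgraph is an induced subgraph which is a path. If $\Lambda'$ is a linear subgraph with consecutive vertices $s_1,\dots,s_n$ (admissible in $\Lambda$, automatic when $\Lambda$ is a tree), order the vertex set of $\Delta_{\Lambda,\Lambda'}$ by $x<y$ iff $x,y$ are adjacent and $x$ has type $\hat s_i$, $y$ has type $\hat s_j$ with $i<j$ (a partial order). $\Delta_{\Lambda,\Lambda'}$ is bowtie free if for any four distinct vertices $x_1,x_2,y_1,y_2$ with $x_i<y_j$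 for all $i,j\in\{1,2\}$ there is a vertex $z$ with $x_i\le z\le y_j$ for all $i,j\in\{1,2\}$. *)

(* Defs.v *)
(* Artin groups are encoded via words over S x bool
   (bool = true means inverse letter) modulo the congruence generated by
   free reduction and the defining relations. *)
From mathcomp Require Import all_boot.
Set Implicit Arguments. Unset Strict Implicit. Unset Printing Implicit Defensive.

Section Artin.
Variable S : finType.

Definition word := seq (S * bool).
Definition inv_letter (x : S * bool) : S * bool := (x.1, ~~ x.2).

Inductive grp_eq (R : word -> word -> Prop) : word -> word -> Prop :=
| grp_eq_refl w : grp_eq R w w
| grp_eq_sym w1 w2 : grp_eq R w1 w2 -> grp_eq R w2 w1
| grp_eq_trans w1 w2 w3 : grp_eq R w1 w2 -> grp_eq R w2 w3 -> grp_eq R w1 w3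
| grp_eq_free u v x : grp_eq R (u ++ x :: inv_letter x :: v) (u ++ v)
| grp_eq_rel u v a b : R a b -> grp_eq R (u ++ a ++ v) (u ++ b ++ v).

Definition alt (s t : S) (n : nat) : word :=
  mkseq (fun i => (if odd i then t else s, false)) n.

Definition artin_rel (m : S -> S -> nat) (a b : word) : Prop :=
  exists s t, s != t /\ a = alt s t (m s t) /\ b = alt t s (m s t).

Definition coxeter_rel (m : S -> S -> nat) (a b : word) : Prop :=
  artin_rel m a b \/ exists s, a = [:: (s, false); (s, false)] /\ b = [::].

Definition artin_eq m := grp_eq (artin_rel m).
Definition coxeter_eq m := grp_eq (coxeter_rel m).

Definition dynkin_matrix (m : S -> S -> nat) : Prop :=
  (forall s t, m s t = m t s) /\ (forall s t, s != t -> 2 <= m s t).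

Definition adj (m : S -> S -> nat) : rel S :=
  fun s t => (s != t) && (2 < m s t).

Definition spherical (m : S -> S -> nat) : Prop :=
  exists l : seq word, forall w, exists2 w', w' \in l & coxeter_eq m w w'.

Definition irreducible (m : S -> S -> nat) : Prop :=
  forall s t, connect (adj m) s t.

Definition linear_subgraph (m : S -> S -> nat) (p : seq S) : Prop :=
  uniq p /\
  forall s t, s \in p -> t \in p ->
    adj m s t = ((index s p).+1 == index t p) || ((index t p).+1 == index s p).

Definition in_coset m (h : word) (U : pred S) (g : word) : Prop :=
  exists u : word, all (fun x => U x.1) u /\ artin_eq m (h ++ u) g.

Definition hat (s : S) : pred S := fun t => t != s.

(* vertex of type \hat s represented by (h, s) : the coset h A_{\hat s} *)
Definition vertex := (word * S)%type.

Definition veq m (x y : vertex) : Prop :=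
  x.2 = y.2 /\ forall g, in_coset m x.1 (hat x.2) g <-> in_coset m y.1 (hat y.2) g.

Definition vadj m (x y : vertex) : Prop :=
  exists g, in_coset m x.1 (hat x.2) g /\ in_coset m y.1 (hat y.2) g.

Definition vlt m (p : seq S) (x y : vertex) : Prop :=
  vadj m x y /\ x.2 \in p /\ y.2 \in p /\ index x.2 p < index y.2 p.

Definition vle m p (x y : vertex) : Prop := veq m x y \/ vlt m p x y.

Definition bowtie_free m (p : seq S) : Prop :=
  forall x1 x2 y1 y2 : vertex,
    x1.2 \in p -> x2.2 \in p -> y1.2 \in p -> y2.2 \in p ->
    ~ veq m x1 x2 -> ~ veq m x1 y1 -> ~ veq m x1 y2 ->
    ~ veq m x2 y1 -> ~ veq m x2 y2 -> ~ veq m y1 y2 ->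
    vlt m p x1 y1 -> vlt m p x1 y2 -> vlt m p x2 y1 -> vlt m p x2 y2 ->
    exists z : vertex, z.2 \in p /\
      vle m p x1 z /\ vle m p x2 z /\ vle m p z y1 /\ vle m p z y2.

End Artin.

(* Main.v *)
(* After multiplication by a power of the central element Z = Delta^2, every coset g A_T is
   represented by an element of the monoid of positive braids, and positive a, b represent the same
   coset iff a x = b y for positive words x, y over T.

   Let x1, x2 (of types a, b) lie below y1, y2 (of types c, d).  From a base point n, each x_i is seen
   as the unique W_i without right divisors in its parabolic such that n W_i represents x_i; a letter
   t is admissible when both cosets of the W_i contain a multiple of t.  Moving the base point inside
   y1 along admissible letters different from c, one stays among finitely many pairs (W_1, W_2).
   At a terminal pair every move can be undone, and conjugation in the Garside monoid then shows that
   each admissible letter fixes the cosets of W_1 and W_2.  Terminal base points n1 in y1 and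
   n2 in y2 have the same W_i, and their join is n1 al = n2 be with al, be supported on the set X of
   admissible letters.  Let C be the connected component of c in X.  If d is not in C, splitting al
   and be along C and X \ C gives a common element of y1 and y2, and z is the smaller of y1, y2.
   Otherwise let k be the last vertex of the path before c and d that is not in C; it is adjacent to
   a letter of C, so that it occurs neither in W_1 nor in W_2, and z = n1 A_k works, k being the
   missing letter. *)
Require Import Defs.
From HB Require Import structures.
From mathcomp Require Import all_boot all_algebra all_field.
From mathcomp Require Import boolp zify ring.
Set Implicit Arguments. Unset Strict Implicit. Unset Printing Implicit Defensive.
Local Open Scope group_scope.

(** * Bounded least common multiples *)

(** A move of the base point along a letter has no inverse among positive elements; what a terminal
    pair provides is only a return to the same remainders. Such a loop gives [c * w = w * g] with
    [g] in the parabolic. Passing from [c] to [g] cannot increase the number of letters in the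
    support; since [w] is invertible up to a central power of Z, the same holds backwards, so the
    supports have equal size. In that case every positive word on the letters of [c] fixes the coset
    of [w], in particular the letter that opened the loop.

    Finiteness of the Coxeter group enters through an element of maximal length, whose lift is
    Delta. The Garside structure is built from the presentation: the order of a product of two
    generators comes from a linear representation, left cancellation from an action on pairs of a
    simple element and a remainder, and the embedding of the monoid in the group from a normal form
    by fractions with denominator a power of Z. *)

Section BoundedLcm.
(* [mul s a] is the product of the letter [s] and [a]; it is only meaningful if [ok s a]. *)
Variables (S U : finType) (T : Type) (one : T) (mul : S -> T -> T) (ok : S -> T -> Prop).
Variables (len : T -> nat) (suppL : S -> {set U}) (supp : T -> {set U}) (le : T -> T -> Prop).
Hypothesis le_refl : forall a, le a a.
Hypothesis le_trans : forall a b c, le a b -> le b c -> le a c.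
Hypothesis le_one : forall a, le one a.
Hypothesis le_mul : forall s a b, ok s a -> ok s b -> le (mul s a) (mul s b) <-> le a b.
Hypothesis le_mulE : forall s a b, ok s a -> le (mul s a) b -> exists2 b', ok s b' & b = mul s b'.
Hypothesis le_ok : forall s a b, ok s b -> le a b -> ok s a.
Hypothesis caseT : forall a, a = one \/ exists s b, ok s b /\ a = mul s b.
Hypothesis len_mul : forall s a, ok s a -> len (mul s a) = (len a).+1.
Hypothesis supp_mul : forall s a, ok s a -> supp (mul s a) = suppL s :|: supp a.
Hypothesis lcm_letters : forall s t a b, s != t -> ok s a -> ok t b -> mul s a = mul t b ->
  exists u v, [/\ ok s u, ok t v, mul s u = mul t v & supp (mul s u) \subset suppL s :|: suppL t] /\
    forall h, (exists2 h', ok s h' & h = mul s h') -> (exists2 h', ok t h' & h = mul t h') ->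
      le (mul s u) h.

(** The product is partial because the lemma serves both divisibilities of the monoid and the weak
    order, where [ok] says that the length goes up. Induction on the length of [g]: for distinct
    first letters, the multiple [s u = t v] lies below [g], so [a'] is joined with [u] and [b'] with
    [v] below shorter bounds, and the results are joined below [g1]. *)
Lemma bounded_lcm a b g : le a g -> le b g ->
  exists j, [/\ le a j, le b j, forall h, le a h -> le b h -> le j h &
    supp j \subset supp a :|: supp b].
Proof.
elim: (len g).+1 {-2}g (ltnSn (len g)) a b => {g} // n IH g ltg a b leag lebg.
have [a1|[s [a' [oka ea]]]] := caseT a.
  by exists b; split=> //; [rewrite a1; apply: le_one|rewrite subsetUr].
have [b1|[t [b' [okb eb]]]] := caseT b.
  by exists a; split=> //; [rewrite b1; apply: le_one|rewrite subsetUl].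
move: leag lebg; rewrite ea eb => leag lebg.
have [g1 okg1 eg1] := le_mulE oka leag.
have [g2 okg2 eg2] := le_mulE okb lebg.
have lg1 : len g1 < n by rewrite eg1 len_mul in ltg.
have lg2 : len g2 < n by rewrite eg2 len_mul in ltg.
have same s0 a0 b0 g0 : len g0 < n -> ok s0 a0 -> ok s0 b0 -> ok s0 g0 -> le a0 g0 -> le b0 g0 ->
   exists j, [/\ le (mul s0 a0) j, le (mul s0 b0) j,
     forall h, le (mul s0 a0) h -> le (mul s0 b0) h -> le j h &
     supp j \subset supp (mul s0 a0) :|: supp (mul s0 b0)].
  move=> lg0 oka0 okb0 okg0 la lb.
  have [j [j1 j2 j3 j4]] := IH _ lg0 _ _ la lb.
  have okj : ok s0 j by apply: (le_ok okg0); apply: j3.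
  exists (mul s0 j); split; try exact/le_mul.
    move=> h lah lbh; have [h' okh eh] := le_mulE oka0 lah.
    move: lah lbh; rewrite eh => /le_mul lah /le_mul lbh.
    by apply/le_mul => //; apply: j3; [apply: lah|apply: lbh].
  rewrite !supp_mul // -setUUr (subset_trans (setUS _ j4)) //.
have [est|nst] := eqVneq s t.
  subst t; apply: (same _ _ _ g1) => //.
    by apply/(le_mul oka okg1); rewrite -eg1.
  by apply/(le_mul okb okg1); rewrite -eg1.
have eg : mul s g1 = mul t g2 by rewrite -eg1 -eg2.
have [u [v [[oku okv euv Su] lD]]] := lcm_letters nst okg1 okg2 eg.
have leDg : le (mul s u) g by apply: lD; [exists g1|exists g2].
have la1 : le a' g1 by apply/(le_mul oka okg1); rewrite -eg1.
have lb2 : le b' g2 by apply/(le_mul okb okg2); rewrite -eg2.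
have lu1 : le u g1 by apply/(le_mul oku okg1); rewrite -eg1.
have lv2 : le v g2 by apply/(le_mul okv okg2); rewrite -eg2 -euv.
have [j1 [aj1 uj1 minj1 Sj1]] := IH _ lg1 _ _ la1 lu1.
have [j2 [bj2 vj2 minj2 Sj2]] := IH _ lg2 _ _ lb2 lv2.
have okj1 : ok s j1 by apply: (le_ok okg1); apply: minj1.
have okj2 : ok t j2 by apply: (le_ok okg2); apply: minj2.
(* Being a multiple of [s u], the element [t j2] begins with [s]; written [s k], it can be joined
   with [s j1] below [g1]. *)
have lDj2 : le (mul s u) (mul t j2) by rewrite euv; apply/le_mul.
have [k okk ek] := le_mulE oku lDj2.
have lj2g : le (mul t j2) g by rewrite eg2; apply/le_mul => //; apply: minj2.
have lk : le k g1.
  by apply/(le_mul okk okg1); rewrite -eg1 -ek.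
have lj1 : le j1 g1 by apply: minj1.
have [j [J1 J2 J3 J4]] := same s j1 k g1 lg1 okj1 okk okg1 lj1 lk.
exists j; split.
- by apply: le_trans J1; apply/le_mul.
- by apply: le_trans J2; rewrite -ek; apply/le_mul.
- move=> h lah lbh.
  have [h1 okh1 eh1] := le_mulE oka lah.
  have [h2 okh2 eh2] := le_mulE okb lbh.
  have lDh : le (mul s u) h by apply: lD; [exists h1|exists h2].
  apply: J3.
    rewrite eh1; apply/le_mul => //; apply: minj1.
      by apply/(le_mul oka okh1); rewrite -eh1.
    by apply/(le_mul oku okh1); rewrite -eh1.
  rewrite -ek eh2; apply/le_mul => //; apply: minj2.
    by apply/(le_mul okb okh2); rewrite -eh2.
  by apply/(le_mul okv okh2); rewrite -eh2 -euv.
- set B := supp (mul s a') :|: supp (mul t b').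
  have [sB tB] : suppL s \subset B /\ suppL t \subset B.
    by split; apply/subsetP => x hx; rewrite /B !supp_mul // !inE hx ?orbT.
  have stB : suppL s :|: suppL t \subset B by rewrite subUset sB.
  have aB : supp a' \subset B by apply/subsetP => x hx; rewrite inE supp_mul // inE hx orbT.
  have bB : supp b' \subset B by apply/subsetP => x hx; rewrite inE (supp_mul okb) inE hx !orbT.
  have uB : supp u \subset B.
    by apply: subset_trans stB; apply: subset_trans Su; rewrite supp_mul // subsetUr.
  have vB : supp v \subset B.
    by apply: subset_trans stB; apply: subset_trans Su; rewrite euv supp_mul // subsetUr.
  have j1B : supp j1 \subset B by apply: subset_trans Sj1 _; rewrite subUset aB.
  have j2B : supp j2 \subset B by apply: subset_trans Sj2 _; rewrite subUset bB.
  apply: (subset_trans J4); rewrite -ek subUset !(supp_mul okj1, supp_mul okj2).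
  by rewrite !subUset sB tB j1B.
Qed.
End BoundedLcm.

(** Induction on the number of elements of [L] reachable from [x]: an irreversible step from [x] to
    [y] loses at least [x] itself. *)
Lemma preorder_terminal (A : eqType) (L : seq A) (R : A -> A -> Prop) (x : A) :
  (forall y, R y y) -> (forall y z w, R y z -> R z w -> R y w) ->
  (forall y, R x y -> y \in L) ->
  exists2 y, R x y & forall z, R y z -> R z y.
Proof.
move=> Rr Rt; set cnt := fun y => count (fun z => `[< R y z >]) L.
elim: (cnt x).+1 {-2}x (ltnSn (cnt x)) => {x} // n IH x ltn RL.
have [nt|/existsNP[y /not_implyP[Rxy nyx]]] := pselect (forall z, R x z -> R z x).
  by exists x.
have [||z Ryz zt] := IH y; last by exists z => //; apply: Rt Ryz.
  rewrite ltnS in ltn; apply: leq_trans ltn; rewrite /cnt.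
  have xL : x \in L by apply: RL.
  have -> : count (fun z => `[< R x z >]) L =
     count (fun z => `[< R y z >]) L + count (fun z => `[< R x z >] && ~~ `[< R y z >]) L.
    rewrite -count_predUI [X in _ = (_ + X)%N](_ : _ = 0) ?addn0; last first.
      by rewrite (@eq_count _ _ pred0) ?count_pred0 // => z /=; case: asboolP => //=; rewrite andbF.
    apply: eq_count => z /=; case: asboolP => [Rxz|nxz]; case: asboolP => //= Ryz.
    by case: nxz; apply: Rt Ryz.
  rewrite -[X in X < _]addn0 ltn_add2l -has_count; apply/hasP; exists x => //.
  by apply/andP; split; [apply/asboolP|apply/asboolPn].
by move=> z Ryz; apply: RL; apply: Rt Ryz.
Qed.

(** * Garside monoids *)

Section Divisibility.
Variable M : monoidType.
Definition dvl (a b : M) := exists c, b = a * c.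
Definition dvr (a b : M) := exists c, b = c * a.

Lemma dvl_refl a : dvl a a. Proof. by exists 1; rewrite mulg1. Qed.
Lemma dvl_trans a b c : dvl a b -> dvl b c -> dvl a c.
Proof. by move=> [x ->] [y ->]; exists (x * y); rewrite mulgA. Qed.
Lemma dvl_mulr a b : dvl a (a * b). Proof. by exists b. Qed.
Lemma dvl1 a : dvl 1 a. Proof. by exists a; rewrite mul1g. Qed.
Lemma dvl_mul2l c a b : dvl a b -> dvl (c * a) (c * b).
Proof. by move=> [x ->]; exists x; rewrite mulgA. Qed.
Lemma dvr_refl a : dvr a a. Proof. by exists 1; rewrite mul1g. Qed.
Lemma dvr_trans a b c : dvr a b -> dvr b c -> dvr a c.
Proof. by move=> [x ->] [y ->]; exists (y * x); rewrite mulgA. Qed.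
Lemma dvr_mull a b : dvr a (b * a). Proof. by exists b. Qed.
Lemma dvr1 a : dvr 1 a. Proof. by exists a; rewrite mulg1. Qed.
End Divisibility.

Section Garside.
Variables (S : finType) (adjS : rel S) (M : monoidType) (gen : S -> M).
Variables (len : M -> nat) (supp : M -> {set S}) (simple : M -> Prop) (Delta Z : M).
Hypothesis adjC : symmetric adjS.
Hypothesis gen_canl : forall s a b, gen s * a = gen s * b -> a = b.
Hypothesis gen_canr : forall s a b, a * gen s = b * gen s -> a = b.
Hypothesis lenM : forall a b, len (a * b) = len a + len b.
Hypothesis len_gen : forall s, len (gen s) = 1%N.
Hypothesis suppM : forall a b, supp (a * b) = supp a :|: supp b.
Hypothesis supp_gen : forall s, supp (gen s) = [set s].
Hypothesis supp1 : supp 1 = set0.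
Hypothesis atoml : forall a, a = 1 \/ exists s b, a = gen s * b.
Hypothesis atomr : forall a, a = 1 \/ exists s b, a = b * gen s.
Hypothesis lcml : forall s t, s != t -> exists u v,
  [/\ gen s * u = gen t * v, supp (gen s * u) \subset [set s; t],
      forall a b, gen s * a = gen t * b -> exists2 e, a = u * e & b = v * e,
      adjS s t -> s \in supp u & ~~ adjS s t -> u = gen t /\ v = gen s].
Hypothesis lcmr : forall s t, s != t -> exists u v,
  [/\ u * gen s = v * gen t, supp (u * gen s) \subset [set s; t] &
      forall a b, a * gen s = b * gen t -> exists2 e, a = e * u & b = e * v].
Hypothesis Zcentral : forall a, a * Z = Z * a.
Hypothesis Zgen : forall s, exists b, gen s * b = Z.
Hypothesis simpleP : forall a, simple a <-> dvl a Delta.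
Hypothesis simple_fac : forall a b, simple (a * b) -> simple a /\ simple b.
Hypothesis simple_sq : forall s a, ~ simple (gen s * (gen s * a)).
Hypothesis simple_l : forall s w, simple w -> dvl (gen s) w \/ simple (gen s * w).
Hypothesis simple_r : forall s w, simple w -> dvr (gen s) w \/ simple (w * gen s).
Hypothesis deodhar : forall t t' w w1, simple (w * gen t') -> w * gen t' = gen t * w1 ->
  ~ dvl (gen t) w -> w1 = w.
Hypothesis Delta_comm : forall s, exists t, gen s * Delta = Delta * gen t.

Implicit Types (a b c d e g h w x y r : M) (s t : S) (X Y T : {set S}).

Lemma len1 : len 1 = 0.
Proof. by move: (lenM 1 1); rewrite mulg1; lia. Qed.

Lemma len0 a : len a = 0 -> a = 1.
Proof. by case: (atoml a) => // -[s [b ->]]; rewrite lenM len_gen. Qed.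

Lemma canl a b c : a * b = a * c -> b = c.
Proof.
elim: (len a) {-2}a (leqnn (len a)) => {a} [|n IH] a.
  by rewrite leqn0 => /eqP/len0 ->; rewrite !mul1g.
case: (atoml a) => [->|[s [a' ->]]]; first by rewrite !mul1g.
by rewrite lenM len_gen add1n ltnS => /IH h; rewrite -!mulgA => /gen_canl /h.
Qed.

Lemma canr a b c : b * a = c * a -> b = c.
Proof.
elim: (len a) {-2}a (leqnn (len a)) b c => {a} [|n IH] a.
  by rewrite leqn0 => /eqP/len0 -> b c; rewrite !mulg1.
case: (atomr a) => [-> _ b c|[s [a' ->]]]; first by rewrite !mulg1.
by rewrite lenM len_gen addn1 ltnS => /IH h b c; rewrite !mulgA => /gen_canr /h.
Qed.

Lemma dvl_pmul c a b : dvl (c * a) (c * b) <-> dvl a b.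
Proof.
by split=> [[x]|]; [rewrite -mulgA => /canl ->; exists x|apply: dvl_mul2l].
Qed.

Lemma dvl_len a b : dvl a b -> len a <= len b.
Proof. by move=> [c ->]; rewrite lenM leq_addr. Qed.

Lemma dvl_len_eq a b : dvl a b -> len b <= len a -> a = b.
Proof.
move=> [c ->]; rewrite lenM -[X in _ <= X]addn0 leq_add2l leqn0 => /eqP/len0 ->.
by rewrite mulg1.
Qed.

Lemma dvl_anti a b : dvl a b -> dvl b a -> a = b.
Proof. by move=> ab ba; apply: dvl_len_eq => //; apply: dvl_len. Qed.

Lemma dvl_yoneda a b : (forall d, dvl a d <-> dvl b d) -> a = b.
Proof. by move=> h; apply: dvl_anti; apply/h; apply: dvl_refl. Qed.

Lemma supp_dvl a b : dvl a b -> supp a \subset supp b.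
Proof. by move=> [c ->]; rewrite suppM subsetUl. Qed.
Lemma supp_fac a b X : supp (a * b) \subset X -> supp a \subset X /\ supp b \subset X.
Proof. by rewrite suppM subUset => /andP[]. Qed.

Lemma supp_mul a b X : supp a \subset X -> supp b \subset X -> supp (a * b) \subset X.
Proof. by rewrite suppM subUset => -> ->. Qed.

Lemma Zcomp a : exists b n, a * b = Z ^+ n.
Proof.
elim: (len a) {-2}a (leqnn (len a)) => {a} [|n IH] a.
  by rewrite leqn0 => /eqP/len0 ->; exists 1, 0; rewrite mulg1.
case: (atoml a) => [-> _|[s [a' ->]]]; first by exists 1, 0; rewrite mulg1.
rewrite lenM len_gen add1n ltnS => /IH [b [k e]].
have [s' es] := Zgen s; exists (b * s'), k.+1.
have cZ x : x * Z ^+ k = Z ^+ k * x.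
  by elim: k {e} => [|k IHk]; rewrite ?mulg1 ?mul1g // expgS mulgA Zcentral -mulgA IHk mulgA.
by rewrite -mulgA (mulgA a') e -cZ mulgA es expgS.
Qed.

Lemma ZXcentral n a : a * Z ^+ n = Z ^+ n * a.
Proof.
by elim: n => [|k IHk]; rewrite ?mulg1 ?mul1g // expgS mulgA Zcentral -mulgA IHk mulgA.
Qed.

Lemma dvl_ZX n k : n <= k -> dvl (Z ^+ n) (Z ^+ k).
Proof. by move=> nk; exists (Z ^+ (k - n)); rewrite -expgnDr subnKC. Qed.

Lemma common_mult a b : exists n, dvl a (Z ^+ n) /\ dvl b (Z ^+ n).
Proof.
have [a' [n ea]] := Zcomp a; have [b' [k eb]] := Zcomp b.
exists (maxn n k); split.
  by apply: dvl_trans (dvl_ZX (leq_maxl _ _)); exists a'.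
by apply: dvl_trans (dvl_ZX (leq_maxr _ _)); exists b'.
Qed.

Lemma lcm_ex a b : exists j, [/\ dvl a j, dvl b j, forall h, dvl a h -> dvl b h -> dvl j h &
    supp j \subset supp a :|: supp b].
Proof.
have [n [an bn]] := common_mult a b.
apply: (@bounded_lcm S S M 1 (fun s a => gen s * a) (fun _ _ => True) len (fun s => [set s]) supp (@dvl M)
  _ _ _ _ _ _ _ _ _ _ a b (Z ^+ n)) => //.
- exact: dvl_refl.
- exact: dvl_trans.
- exact: dvl1.
- by move=> s x y _ _; apply: dvl_pmul.
- by move=> s x y _ [c ->]; exists (x * c); rewrite ?mulgA.
- by move=> x; case: (atoml x) => [|[s [y]]]; [left|right; exists s, y].
- by move=> s x _; rewrite lenM len_gen.
- by move=> s x _; rewrite suppM supp_gen.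
move=> s t x y st _ _ e; have [u [v [euv Su lu _ _]]] := lcml st.
exists u, v; split=> // h [h1 _ e1] [h2 _ e2].
have [e' e3 _] := lu h1 h2 (etrans (esym e1) e2).
by exists e'; rewrite e1 e3 mulgA.
Qed.

Definition join a b := sval (cid (lcm_ex a b)).
Lemma joinl a b : dvl a (join a b). Proof. by rewrite /join; case: cid => j []. Qed.
Lemma joinr a b : dvl b (join a b). Proof. by rewrite /join; case: cid => j []. Qed.
Lemma join_min a b h : dvl a h -> dvl b h -> dvl (join a b) h.
Proof. by rewrite /join; case: cid => j [] /= _ _ m _; apply: m. Qed.
Lemma supp_join a b X : supp a \subset X -> supp b \subset X -> supp (join a b) \subset X.
Proof.
move=> aX bX; rewrite /join; case: cid => j [] /= _ _ _ h.
by apply: subset_trans h _; rewrite subUset aX.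
Qed.
Lemma joinC a b : join a b = join b a.
Proof. by apply: dvl_anti; apply: join_min; rewrite ?joinl; solve [apply: joinl|apply: joinr]. Qed.

(* [res a b] is the complement of [a] in the least common multiple of [a] and [b]. *)
Definition res a b := sval (cid (joinl a b)).
Lemma resE a b : a * res a b = join a b.
Proof. by rewrite /res; case: cid. Qed.
Lemma res_comm a b : a * res a b = b * res b a.
Proof. by rewrite !resE joinC. Qed.
Lemma res_dvl a b c : dvl (res a b) c <-> dvl b (a * c).
Proof.
rewrite -(dvl_pmul a) resE; split=> h; first by apply: dvl_trans h; apply: joinr.
by apply: join_min => //; apply: dvl_mulr.
Qed.
Lemma res_mulr a b c : res a (b * c) = res a b * res (res b a) c.
Proof.
apply: dvl_yoneda => d; rewrite res_dvl; split.
  move=> h.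
  have /res_dvl[e ed] : dvl b (a * d) by apply: dvl_trans h; apply: dvl_mulr.
  rewrite ed; apply: dvl_mul2l; apply/res_dvl.
  by move: h; rewrite ed mulgA res_comm -mulgA dvl_pmul.
move=> [e ->]; rewrite !mulgA res_comm -!mulgA dvl_pmul.
by apply/res_dvl; apply: dvl_mulr.
Qed.
Lemma res_mull a b c : res (a * b) c = res b (res a c).
Proof. by apply: dvl_yoneda => d; rewrite !res_dvl mulgA. Qed.
Lemma res1 a : res a 1 = 1.
Proof. by apply: dvl_anti; [apply/res_dvl; apply: dvl1|apply: dvl1]. Qed.
Lemma res1l a : res 1 a = a.
Proof. by apply: dvl_yoneda => d; rewrite res_dvl mul1g. Qed.
Lemma res_eq1 a b : res a b = 1 <-> dvl b a.
Proof.
split=> [h|h]; first by have := res_comm a b; rewrite h mulg1 => ->; apply: dvl_mulr.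
by apply: dvl_anti; [apply/res_dvl; rewrite mulg1|apply: dvl1].
Qed.
Lemma supp_res a b X : supp a \subset X -> supp b \subset X -> supp (res a b) \subset X.
Proof.
by move=> aX bX; have := supp_join aX bX; rewrite -resE => /supp_fac[].
Qed.
Lemma greatest_div (P : M -> Prop) a : P 1 -> (forall x y, P x -> P y -> P (join x y)) ->
  (forall x, P x -> dvl x a) -> exists2 x, P x & forall y, P y -> dvl y x.
Proof.
move=> P1 PJ Pa.
pose p n := `[< exists2 x, P x & len x = n >].
have ex : exists n, p n by exists 0; apply/asboolP; exists 1; rewrite ?len1.
have ub n : p n -> n <= len a by move=> /asboolP[x Px <-]; apply: dvl_len; apply: Pa.
case: (ex_maxnP ex ub) => n /asboolP[x Px lx] mx; exists x => // y Py.
have /mx : p (len (join x y)) by apply/asboolP; exists (join x y) => //; apply: PJ.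
by rewrite -lx => /(dvl_len_eq (joinl x y)) e; rewrite [X in dvl _ X]e; apply: joinr.
Qed.

Lemma meet_ex a b : exists d, [/\ dvl d a, dvl d b & forall e, dvl e a -> dvl e b -> dvl e d].
Proof.
have [|||d [da db] dm] := @greatest_div (fun x => dvl x a /\ dvl x b) a.
- by split; apply: dvl1.
- by move=> x y [xa xb] [ya yb]; split; apply: join_min.
- by move=> x [].
by exists d; split=> // e ea eb; apply: dm.
Qed.
Definition meet a b := sval (cid (meet_ex a b)).
Lemma meetl a b : dvl (meet a b) a. Proof. by rewrite /meet; case: cid => j []. Qed.
Lemma meetr a b : dvl (meet a b) b. Proof. by rewrite /meet; case: cid => j []. Qed.
Lemma meet_max a b e : dvl e a -> dvl e b -> dvl e (meet a b).
Proof. by rewrite /meet; case: cid => j [] /= _ _ m; apply: m. Qed.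
Lemma meet_mul2l c a b : meet (c * a) (c * b) = c * meet a b.
Proof.
have [d ed] : dvl c (meet (c * a) (c * b)) by apply: meet_max; apply: dvl_mulr.
have := meetl (c * a) (c * b); have := meetr (c * a) (c * b).
rewrite ed !dvl_pmul => db da; congr (_ * _).
apply: dvl_anti; first exact: meet_max.
by apply/(dvl_pmul c); rewrite -ed; apply: meet_max; apply: dvl_mul2l; [apply: meetl|apply: meetr].
Qed.

Lemma pre_ex X a : exists d, (supp d \subset X /\ dvl d a) /\
  forall e, supp e \subset X -> dvl e a -> dvl e d.
Proof.
have [|||d dP dm] := @greatest_div (fun x => supp x \subset X /\ dvl x a) a.
- by rewrite supp1 sub0set; split=> //; apply: dvl1.
- by move=> x y [xa xb] [ya yb]; split; [apply: supp_join|apply: join_min].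
- by move=> x [].
by exists d; split=> // e ea eb; apply: dm.
Qed.
Definition pre X a := sval (cid (pre_ex X a)).
Lemma supp_pre X a : supp (pre X a) \subset X. Proof. by rewrite /pre; case: cid => j [] []. Qed.
Lemma pre_dvl X a : dvl (pre X a) a. Proof. by rewrite /pre; case: cid => j [] []. Qed.
Lemma pre_max X a e : supp e \subset X -> dvl e a -> dvl e (pre X a).
Proof. by rewrite /pre; case: cid => j [] /= _ m; apply: m. Qed.

Definition lred X a := forall t, t \in X -> ~ dvl (gen t) a.

Lemma lredP X a : lred X a <-> forall e, supp e \subset X -> dvl e a -> e = 1.
Proof.
split=> h; last first.
  move=> t tX /h; rewrite supp_gen sub1set tX => /(_ isT) /(congr1 len).
  by rewrite len_gen len1.
move=> e eX ea; case: (atoml e) => // -[s [b eb]].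
case: (h s); last by apply: dvl_trans ea; rewrite eb; apply: dvl_mulr.
by apply: (subsetP eX); rewrite eb suppM supp_gen !inE eqxx.
Qed.

Lemma lred_dvl X a b : dvl a b -> lred X b -> lred X a.
Proof. by move=> ab h t tX ta; apply: (h t tX); apply: dvl_trans ab. Qed.

Lemma pre_lred X a b : a = pre X a * b -> lred X b.
Proof.
move=> e; apply/lredP => d dX [c ec].
have : dvl (pre X a * d) (pre X a).
  apply: pre_max; first by apply: supp_mul => //; apply: supp_pre.
  by rewrite [X in dvl _ X]e ec mulgA; apply: dvl_mulr.
by move/dvl_len; rewrite lenM => h; apply: len0; lia.
Qed.

(** The complement of [v] in the join of [v] and [e] is supported on [X] and divides [w], so it is
    trivial. *)
Lemma dvl_lred_mul X v w e : lred X w -> supp v \subset X -> supp e \subset X ->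
  dvl e (v * w) -> dvl e v.
Proof.
move=> /lredP rw vX eX /res_dvl /rw h; apply/res_eq1; apply: h.
exact: supp_res.
Qed.

(** * Right-reduced representatives of cosets *)

Lemma dvr_lcm a b g : dvr a g -> dvr b g -> exists j, [/\ dvr a j, dvr b j, dvr j g &
    supp j \subset supp a :|: supp b].
Proof.
move=> ag bg.
have pm c x y : dvr (x * c) (y * c) <-> dvr x y.
  split=> [[z]|[z ->]]; last by exists z; rewrite mulgA.
  by rewrite mulgA => /canr ->; exists z.
suff [j [ja jb jm sj]] : exists j, [/\ dvr a j, dvr b j, forall h, dvr a h -> dvr b h -> dvr j h &
    supp j \subset supp a :|: supp b].
  by exists j; split=> //; apply: jm.
apply: (@bounded_lcm S S M 1 (fun s a => a * gen s) (fun _ _ => True)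
   len (fun s => [set s]) supp (@dvr M) _ _ _ _ _ _ _ _ _ _ a b g ag bg) => //.
- exact: dvr_refl.
- exact: dvr_trans.
- exact: dvr1.
- by move=> s x y _ [c ->]; exists (c * x); rewrite ?mulgA.
- by move=> x; case: (atomr x) => [|[s [y]]]; [left|right; exists s, y].
- by move=> s x _; rewrite lenM len_gen addn1.
- by move=> s x _; rewrite suppM supp_gen setUC.
- move=> s t x y st _ _ e; have [u [v [euv Su lu]]] := lcmr st.
  exists u, v; split=> // h [h1 _ e1] [h2 _ e2].
  have [e' e3 _] := lu h1 h2 (etrans (esym e1) e2).
  by exists e'; rewrite e1 e3 mulgA.
Qed.

Definition rred T a := forall t, t \in T -> ~ dvr (gen t) a.

Lemma rredP T a e r : rred T a -> a = e * r -> supp r \subset T -> r = 1.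
Proof.
move=> ra ea; case: (atomr r) => // -[s [b eb]]; rewrite eb suppM supp_gen => sT.
case: (ra s); first by apply: (subsetP sT); rewrite !inE eqxx orbT.
by rewrite ea eb mulgA; apply: dvr_mull.
Qed.

Lemma mu_ex T a : exists c, rred T c /\ exists2 r, a = c * r & supp r \subset T.
Proof.
elim: (len a) {-2}a (leqnn (len a)) => {a} [|n IH] a la.
  exists 1; split; last by exists 1; rewrite ?mulg1 ?supp1 ?sub0set //; apply: len0; lia.
  by move=> t _ [c /(congr1 len)]; rewrite lenM len_gen len1; lia.
have [ra|/existsNP[t /not_implyP[tT /contrapT[b eb]]]] := pselect (rred T a).
  by exists a; split=> //; exists 1; rewrite ?mulg1 ?supp1 ?sub0set.
have [|c [rc [r er rT]]] := IH b; first by move: la; rewrite eb lenM len_gen; lia.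
exists c; split=> //; exists (r * gen t); first by rewrite eb er mulgA.
by apply: supp_mul => //; rewrite supp_gen sub1set.
Qed.

(** A common left multiple of [r] and [r'] that is still supported on [T] divides the common value
    on the right. So [c] and [c'] differ only by right factors over [T], which are trivial. *)
Lemma rred_uniq T c c' r r' : rred T c -> rred T c' -> supp r \subset T -> supp r' \subset T ->
  c * r = c' * r' -> c = c'.
Proof.
move=> rc rc' rT r'T e.
have [j [[x ex] [y ey] [z ez] sj]] := dvr_lcm (dvr_mull r c) (ex_intro _ c' e).
have jT : supp j \subset T by apply: subset_trans sj _; rewrite subUset rT.
have : c = z * x by apply: (@canr r); rewrite ez ex mulgA.
have : c' = z * y by apply: (@canr r'); rewrite -e ez ey mulgA.
have [xT _] : supp x \subset T /\ supp r \subset T by apply: supp_fac; rewrite -ex.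
have [yT _] : supp y \subset T /\ supp r' \subset T by apply: supp_fac; rewrite -ey.
by move=> e2 e1; rewrite e1 e2 (rredP rc e1 xT) (rredP rc' e2 yT).
Qed.

Definition mu T a := sval (cid (mu_ex T a)).
Lemma mu_rred T a : rred T (mu T a). Proof. by rewrite /mu; case: cid => c []. Qed.
Lemma muE T a : exists2 r, a = mu T a * r & supp r \subset T.
Proof. by rewrite /mu; case: cid => c []. Qed.
Lemma mu_uniq T a c r : a = c * r -> rred T c -> supp r \subset T -> mu T a = c.
Proof.
move=> e rc rT; have [r' e' r'T] := muE T a.
by apply: (@rred_uniq T (mu T a) c r' r) => //; [apply: mu_rred|rewrite -e' e].
Qed.
Lemma mu_id T c : rred T c -> mu T c = c.
Proof. by move=> rc; apply: (@mu_uniq T c c 1); rewrite ?mulg1 ?supp1 ?sub0set. Qed.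
Lemma mu_mulr T a r : supp r \subset T -> mu T (a * r) = mu T a.
Proof.
move=> rT; have [r' e' r'T] := muE T a.
apply: (@mu_uniq T _ _ (r' * r)); [by rewrite mulgA -e'|exact: mu_rred|exact: supp_mul].
Qed.
Lemma mu_dvl T a : dvl (mu T a) a.
Proof. by have [r e _] := muE T a; rewrite [X in dvl _ X]e; apply: dvl_mulr. Qed.

(** Equality of the cosets of [a] and [b]. Comparing reduced representatives makes it an equivalence
    at once; [ceqP] recovers the form by positive words over [T]. *)
Definition ceq T a b := mu T a = mu T b.

Lemma ceqP T a b : ceq T a b <-> exists x y, [/\ supp x \subset T, supp y \subset T & a * x = b * y].
Proof.
split=> [e|[x [y [xT yT e]]]]; last by rewrite /ceq -(mu_mulr a xT) e mu_mulr.
have [r ea rT] := muE T a; have [r' eb r'T] := muE T b.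
exists (res r r'), (res r' r); split; try exact: supp_res.
by rewrite ea eb e -!mulgA res_comm.
Qed.

Lemma ceq_sym T a b : ceq T a b -> ceq T b a. Proof. by []. Qed.
Lemma ceq_trans T a b c : ceq T a b -> ceq T b c -> ceq T a c.
Proof. by rewrite /ceq => -> ->. Qed.
Lemma ceq_mulr T a r : supp r \subset T -> ceq T (a * r) a.
Proof. exact: mu_mulr. Qed.
Lemma ceq_mu T a : ceq T (mu T a) a.
Proof. by rewrite /ceq mu_id //; apply: mu_rred. Qed.
Lemma ceq_pmul T n a b : ceq T (n * a) (n * b) <-> ceq T a b.
Proof.
rewrite !ceqP; split=> -[x [y [xT yT e]]]; exists x, y; split=> //.
  by move: e; rewrite -!mulgA => /canl.
by rewrite -!mulgA e.
Qed.
Lemma ceq_mul2l T n a b : ceq T a b -> ceq T (n * a) (n * b).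
Proof. by move=> h; apply/ceq_pmul. Qed.
Lemma ceq_sub T T' a b : T \subset T' -> ceq T a b -> ceq T' a b.
Proof.
move=> TT /ceqP[x [y [xT yT e]]]; apply/ceqP; exists x, y.
by split=> //; apply: subset_trans TT.
Qed.

(** An element between [mu T a] and [a] cuts the factor [r] into two factors over [T]. Cosets are
    therefore convex for divisibility, hence closed under meets and joins. *)
Lemma ceq_between T a d : dvl (mu T a) d -> dvl d a -> ceq T d a.
Proof.
move=> [x ed] [y ea]; have [r e rT] := muE T a.
apply: ceq_sym; rewrite /ceq [in LHS]ea ed.
have exy : r = x * y by apply: (canl (a := mu T a)); rewrite -e mulgA -ed.
have [xT yT] : supp x \subset T /\ supp y \subset T by apply: supp_fac; rewrite -exy.
by rewrite !mu_mulr.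
Qed.

Lemma ceq_meet T a b : ceq T a b -> ceq T (meet a b) a.
Proof.
move=> e; apply: ceq_between; last exact: meetl.
by apply: meet_max; [|rewrite e]; apply: mu_dvl.
Qed.

Lemma ceq_join T a b : ceq T a b -> ceq T (join a b) a.
Proof.
move=> /[dup] eab /ceqP[x [y [xT yT e]]].
have eax : ceq T (a * x) a := ceq_mulr a xT.
apply: (ceq_trans _ eax); apply: ceq_between.
  by rewrite eax; apply: dvl_trans (joinl _ _); apply: mu_dvl.
by apply: join_min; [|rewrite e]; apply: dvl_mulr.
Qed.

Lemma ceq_convex T a b d : ceq T a b -> dvl a d -> dvl d b -> ceq T d b.
Proof. by move=> e ad; apply: ceq_between; rewrite -e; apply: dvl_trans ad; apply: mu_dvl. Qed.

(** Admissibility for a single coset, with an arbitrary element in place of a letter. *)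
Definition below T a n := exists2 g, ceq T g a & dvl n g.

Lemma below_ceq T a b n : ceq T a b -> below T a n -> below T b n.
Proof. by move=> e [g ga ng]; exists g => //; apply: ceq_trans e. Qed.

Lemma below_join T a n n' : below T a n -> below T a n' -> below T a (join n n').
Proof.
move=> [g ga ng] [g' ga' ng']; exists (join g g').
  by apply: (ceq_trans _ ga); apply: ceq_join; apply: (ceq_trans ga (ceq_sym ga')).
by apply: join_min; [apply: dvl_trans ng (joinl _ _)|apply: dvl_trans ng' (joinr _ _)].
Qed.

Lemma below_dvl T a n n' : dvl n n' -> below T a n' -> below T a n.
Proof. by move=> nn [g ga ng]; exists g => //; apply: dvl_trans ng. Qed.

(** A right-reduced [W] divides every element of its coset, so a multiple of [c] there is a multiple
    of the join of [W] and [c], which by convexity is in the coset too. The condition becomes one on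
    supports. *)
Lemma belowP T W c : rred T W -> below T W c <-> supp (res W c) \subset T.
Proof.
move=> rW; split=> [[g gW cg]|h]; last first.
  by exists (W * res W c); [apply: ceq_mulr|rewrite res_comm; apply: dvl_mulr].
have Wg : dvl W g by rewrite -(mu_id rW) -gW; apply: mu_dvl.
have : ceq T (join W c) W.
  by apply: (ceq_trans _ gW); apply: (ceq_convex (ceq_sym gW)); [apply: joinl|apply: join_min].
rewrite -resE => e; have [r] := muE T (W * res W c).
by rewrite e mu_id // => /canl ->.
Qed.

Lemma below_pmul T W n c : below T (n * W) (n * c) <-> below T W c.
Proof.
split=> [[g gW [h eh]]|[g gW cg]]; last first.
  by exists (n * g); [apply: ceq_mul2l|apply: dvl_mul2l].
exists (c * h); last exact: dvl_mulr.
by move: gW; rewrite eh -mulgA => /ceq_pmul.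
Qed.

(* If the coset of [W] contains a multiple of [c], its translate by the inverse of [c]
   has the right-reduced representative [shift T W c]. *)
Definition shift T W c := mu T (res c W).

Lemma shift_rred T W c : rred T (shift T W c). Proof. exact: mu_rred. Qed.

Lemma shiftP T W c : rred T W -> below T W c -> ceq T (c * shift T W c) W.
Proof.
move=> rW /(belowP _ rW) h; apply: (@ceq_trans _ _ (c * res c W)).
  by apply: ceq_mul2l; apply: ceq_mu.
by rewrite res_comm; apply: ceq_mulr.
Qed.

Lemma ceq_rred T a b : rred T a -> rred T b -> ceq T a b -> a = b.
Proof. by move=> ra rb; rewrite /ceq !mu_id. Qed.

Lemma shift_uniq T W c V : rred T W -> rred T V -> ceq T (c * V) W -> shift T W c = V.
Proof.
move=> rW rV e; apply: (@ceq_rred T) => //; first exact: shift_rred.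
apply/(ceq_pmul T c); apply: ceq_trans (ceq_sym e); apply: shiftP => //.
by exists (c * V) => //; apply: dvl_mulr.
Qed.

(** * Simple elements *)

Lemma simple1 : simple 1. Proof. by apply/simpleP; apply: dvl1. Qed.

Lemma simple_gen s : simple (gen s).
Proof.
case: (simple_l s simple1); last by rewrite mulg1.
by move=> [c /(congr1 len)]; rewrite lenM len_gen len1.
Qed.

(** If putting the first letter [s] of [v] in front broke simplicity, [s] would divide [v' * w],
    hence [v'], and [v] would begin with a square. *)
Lemma simple_mul_lred X v w : simple v -> supp v \subset X -> simple w -> lred X w ->
  simple (v * w).
Proof.
move=> + + sw rw; elim: (len v) {-2}v (leqnn (len v)) => {v} [|n IH] v.
  by rewrite leqn0 => /eqP/len0 ->; rewrite mul1g.
case: (atoml v) => [->|[s [v' ev]]]; first by rewrite mul1g.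
rewrite ev lenM len_gen add1n ltnS => lv sv /supp_fac[sX v'X].
have [_ sv'] := simple_fac sv.
case: (simple_l s (IH v' lv sv' v'X)); last by rewrite mulgA.
move/(dvl_lred_mul rw v'X sX) => [v'' ev']; move: sv; rewrite ev'.
by move/simple_sq.
Qed.

(* With [Delta = y * gen t * D], where [y * gen t] is the greatest prefix of [Delta] supported on
   [X], the product [y * w] is simple, so that [gen t * D] is a common multiple of [gen t] and [w]. *)
Lemma res_gen_lred X w t : simple w -> lred X w -> t \in X ->
  simple (res (gen t) w) /\ lred X (res (gen t) w).
Proof.
move=> sw rw tX.
have [D eD] := pre_dvl X Delta.
have rD := pre_lred eD.
have sP : simple (pre X Delta) by apply/simpleP; apply: pre_dvl.
have [y ey] : dvr (gen t) (pre X Delta).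
  case: (simple_r t sP) => // /simpleP h.
  have : dvl (pre X Delta * gen t) (pre X Delta).
    by apply: pre_max => //; apply: supp_mul; rewrite ?supp_pre // supp_gen sub1set.
  by move/dvl_len; rewrite lenM len_gen; lia.
have [yX _] : supp y \subset X /\ supp (gen t) \subset X.
  by apply: supp_fac; rewrite -ey; apply: supp_pre.
have [sy _] : simple y /\ simple (gen t) by apply: simple_fac; rewrite -ey.
have : dvl (y * w) Delta by apply/simpleP; apply: (simple_mul_lred sy yX).
rewrite eD ey -mulgA dvl_pmul => /res_dvl h; split; last exact: lred_dvl rD.
have : simple (join (gen t) w).
  by apply/simpleP; apply: join_min; apply/simpleP => //; apply: simple_gen.
by rewrite -resE => /simple_fac[].
Qed.

Definition orth s t := (s != t) && ~~ adjS s t.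

Lemma orth_res s t : orth s t -> gen s * gen t = gen t * gen s /\ res (gen s) (gen t) = gen t.
Proof.
move=> /andP[st ns]; have [u [v [e _ m _ /(_ ns)[eu ev]]]] := lcml st.
have c : gen s * gen t = gen t * gen s by move: e; rewrite eu ev.
split=> //; apply: dvl_anti; first by apply/res_dvl; exists (gen s).
have [x ex _] := m _ _ (res_comm (gen s) (gen t)).
by rewrite ex eu; apply: dvl_mulr.
Qed.

Lemma orth_comm s y : (forall t, t \in supp y -> orth s t) ->
  gen s * y = y * gen s /\ res (gen s) y = y.
Proof.
elim: (len y) {-2}y (leqnn (len y)) => {y} [|n IH] y.
  by rewrite leqn0 => /eqP/len0 -> _; rewrite mulg1 mul1g res1.
case: (atoml y) => [-> _ _|[t [y' ->]]]; first by rewrite mulg1 mul1g res1.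
rewrite lenM len_gen add1n ltnS => ly h.
have ht : orth s t by apply: h; rewrite suppM supp_gen !inE eqxx.
have [c1 c2] : gen s * y' = y' * gen s /\ res (gen s) y' = y'.
  by apply: IH => // t' t'y; apply: h; rewrite suppM inE t'y orbT.
have [d1 d2] := orth_res ht; split; first by rewrite mulgA d1 -!mulgA c1.
rewrite res_mulr d2; congr (_ * _).
suff -> : res (gen t) (gen s) = gen s by [].
by apply: (canl (a := gen t)); rewrite -res_comm d2.
Qed.

(** Push [s] through [y]: it crosses commuting letters unchanged, and at the first adjacent letter
    the complement contains [s] by the corresponding clause of [lcml]. *)
Lemma mem_supp_res s y : ~ dvl (gen s) y -> (exists2 t, t \in supp y & ~~ orth s t) ->
  s \in supp (res (gen s) y).
Proof.
elim: (len y) {-2}y (leqnn (len y)) => {y} [|n IH] y.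
  by rewrite leqn0 => /eqP/len0 -> _ [t]; rewrite supp1 inE.
case: (atoml y) => [-> _ _ [t]|[t [y' ->]]]; first by rewrite supp1 inE.
rewrite lenM len_gen add1n ltnS => ly ns [t' t'y nt'].
have st : s != t by apply/eqP => est; apply: ns; rewrite est; apply: dvl_mulr.
have [ost|nost] := boolP (orth s t); last first.
  have ad : adjS s t by move: nost; rewrite /orth st /= negbK.
  have [u [v [e _ m /(_ ad) su _]]] := lcml st.
  have [x -> _] : exists2 x, res (gen s) (gen t * y') = u * x &
      y' * res (gen t * y') (gen s) = v * x by apply: m; rewrite res_comm mulgA.
  by rewrite suppM inE su.
have [d1 d2] := orth_res ost.
rewrite res_mulr d2 suppM inE.
have -> : res (gen t) (gen s) = gen s by apply: (canl (a := gen t)); rewrite -res_comm d2.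
apply/orP; right; apply: IH => //.
  move=> [z ez]; apply: ns; rewrite ez mulgA -d1 -mulgA; exact: dvl_mulr.
exists t' => //; move: t'y; rewrite suppM supp_gen !inE => /orP[/eqP e|//].
by move: nt'; rewrite e ost.
Qed.

(** * Commutation from a missing letter *)

(* A maximal suffix of [q] that commutes with [res q (gen s)] is split off: the letter preceding
   it occurs in [res q (gen s)]. *)
Lemma res_gen_split q s : s \notin supp q ->
  [/\ simple (res q (gen s)), lred [set~ s] (res q (gen s)) &
  exists q1 q2, [/\ q = q1 * q2, res q (gen s) = res q1 (gen s),
     forall x : S, x \in supp q2 -> forall t, t \in supp (res q (gen s)) -> orth x t &
     q1 = 1 \/ exists q1' (x : S), q1 = q1' * gen x /\ x \in supp (res q (gen s))]].
Proof.
elim: (len q) {-2}q (leqnn (len q)) => {q} [|n IH] q.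
  rewrite leqn0 => /eqP/len0 -> _; rewrite res1l; split.
  - exact: simple_gen.
  - move=> t; rewrite !inE => ts [c ec]; have := congr1 len ec.
    rewrite lenM !len_gen => lc; have c1 : c = 1 by apply: len0; lia.
    have := supp_gen s; rewrite ec c1 mulg1 supp_gen => /setP/(_ t).
    by rewrite !inE eqxx (negbTE ts).
  - exists 1, 1; rewrite mulg1 res1l; split=> //; last by left.
    by move=> x; rewrite supp1 inE.
case: (atomr q) => [-> _ _|[x [q' eq]]].
  by apply: (IH 1); rewrite ?len1 ?supp1 ?inE.
rewrite eq lenM len_gen addn1 ltnS => lq; rewrite suppM supp_gen !inE negb_or => /andP[sq' sx].
have [sy ry [q1 [q2 [eq' e1 h2 h1]]]] := IH _ lq sq'.
set y := res q' (gen s) in sy ry e1 h2 h1.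
have xs : x \in [set~ s] by rewrite !inE eq_sym.
have [sy' ry'] := res_gen_lred sy ry xs.
rewrite res_mull -/y; split=> //.
have [hx|] := pselect (forall t, t \in supp y -> orth x t).
  have [cy ey] := orth_comm hx; rewrite ey.
  exists q1, (q2 * gen x); split=> //; first by rewrite eq' mulgA.
  by move=> z; rewrite suppM supp_gen !inE => /orP[/h2|/eqP ->].
move=> /existsNP[t /not_implyP[ty /negP nt]].
exists (q' * gen x), 1; split=> //.
- by rewrite mulg1.
- by rewrite res_mull.
- by move=> z; rewrite supp1 inE.
right; exists q', x; split=> //; apply: mem_supp_res; last by exists t.
exact: ry.
Qed.

(** In the splitting of [q], a nontrivial [q1] would end with a letter [x] that lies in [T] and
    commutes with [q2]; moved to the right end, it contradicts right-reducedness. So [q = q2], and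
    the complement of [s] is [s] itself. *)
Lemma orth_of_missing T q s : rred T q -> s \notin supp q -> supp (res q (gen s)) \subset T ->
  forall x : S, x \in supp q -> orth x s.
Proof.
move=> rq sq yT; have [_ _ [q1 [q2 [eq e1 h2 [q11|[q1' [x [eq1 xy]]]]]]]] := res_gen_split sq.
  move=> x; rewrite eq q11 mul1g => /h2; apply.
  by rewrite e1 q11 res1l supp_gen inE.
case: (rq x); first exact: (subsetP yT).
have [c _] : gen x * q2 = q2 * gen x /\ res (gen x) q2 = q2.
  by apply: orth_comm => t /h2 /(_ x xy); rewrite /orth eq_sym adjC.
by rewrite eq eq1 -mulgA c mulgA; apply: dvr_mull.
Qed.

(** * Conjugation of positive elements and supports *)

(** Letter by letter: the complement of a letter of [X] is nontrivial since that letter does not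
    divide [w]; if it has length 1, [deodhar] shows that the letter crosses [w] and leaves it
    unchanged. *)
Lemma len_res_lred X w c : simple w -> lred X w -> supp c \subset X ->
  len c <= len (res w c) /\ (len (res w c) <= len c -> res c w = w /\
    forall t, t \in supp c -> exists t', gen t * w = w * gen t').
Proof.
move=> + + ; elim: (len c) {-2}c (leqnn (len c)) w => {c} [|n IH] c.
  by rewrite leqn0 => /eqP/len0 -> w _ _ _; rewrite len1 res1l; split=> // _; split=> // t; rewrite supp1 inE.
case: (atoml c) => [-> _ w _ _ _|[t [c' ->]]].
  by rewrite len1 res1l; split=> // _; split=> // t; rewrite supp1 inE.
rewrite lenM len_gen add1n ltnS => lc w sw rw /supp_fac[tX c'X].
have {}tX : t \in X by apply: (subsetP tX); rewrite supp_gen inE.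
have [sw1 rw1] := res_gen_lred sw rw tX.
have [h1 h2] := IH _ lc _ sw1 rw1 c'X.
have l1 : 0 < len (res w (gen t)).
  by rewrite lt0n; apply/eqP => /len0/res_eq1; apply: rw.
rewrite res_mulr lenM res_mull; split; first by lia.
move=> h3.
have {}/h2 h2 : len (res (res (gen t) w) c') <= len c' by lia.
have l1' : len (res w (gen t)) = 1%N by lia.
have [t' et'] : exists t', res w (gen t) = gen t'.
  case: (atoml (res w (gen t))) => [e|[t' [z ez]]]; first by rewrite e len1 in l1.
  exists t'; rewrite ez (_ : z = 1) ?mulg1 //; apply: len0.
  by move: l1'; rewrite ez lenM len_gen; lia.
have e : w * gen t' = gen t * res (gen t) w by rewrite -et' res_comm.
have s' : simple (w * gen t').
  by rewrite -et' resE; apply/simpleP; apply: join_min; apply/simpleP => //; apply: simple_gen.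
have ew : res (gen t) w = w by apply: (deodhar s' e); apply: rw.
rewrite ew in h2 e *; case: h2 => e2 h2; split=> // t0.
rewrite suppM supp_gen !inE => /orP[/eqP ->|]; last exact: h2.
by exists t'.
Qed.

Lemma conj_letters w (f : S -> S) X : (forall t, t \in X -> gen t * w = w * gen (f t)) ->
  forall h, supp h \subset X -> exists2 h', h * w = w * h' & supp h' = f @: supp h.
Proof.
move=> hf h; elim: (len h) {-2}h (leqnn (len h)) => {h} [|n IH] h.
  by rewrite leqn0 => /eqP/len0 -> _; exists 1; rewrite ?mulg1 ?mul1g // supp1 imset0.
case: (atoml h) => [-> _ _|[t [h' ->]]]; first by exists 1; rewrite ?mulg1 ?mul1g // supp1 imset0.
rewrite lenM len_gen add1n ltnS => lh /supp_fac[tX hX].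
have [h1 e1 s1] := IH _ lh hX; exists (gen (f t) * h1).
  by rewrite -mulgA e1 !mulgA hf //; apply: (subsetP tX); rewrite supp_gen inE.
by rewrite !suppM !supp_gen imsetU imset_set1 s1.
Qed.

Lemma dvl_Delta_comm a : dvl Delta (a * Delta).
Proof.
elim: (len a) {-2}a (leqnn (len a)) => {a} [|n IH] a.
  by rewrite leqn0 => /eqP/len0 ->; rewrite mul1g; apply: dvl_refl.
case: (atomr a) => [-> _|[t [a' ->]]]; first by rewrite mul1g; apply: dvl_refl.
rewrite lenM len_gen addn1 ltnS => /IH la; have [t' e] := Delta_comm t.
by rewrite -mulgA e mulgA; apply: dvl_trans la (dvl_mulr _ _).
Qed.

(** Induction on [w], removing on the left its greatest prefix over the support of [c] or, when this
    is trivial, its greatest simple prefix. The first removal changes [c] inside its support, the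
    second carries [c] to its conjugate letter by letter. So the size of the support cannot grow,
    and when it is kept, both steps carry the claim on cosets back to [w]. *)
Lemma positive_conj_supp c w g : c * w = w * g ->
  #|supp g| <= #|supp c| /\ (#|supp c| <= #|supp g| ->
    forall h, supp h \subset supp c -> ceq (supp g) (h * w) w).
Proof.
elim: (len w) {-2}w (leqnn (len w)) c g => {w} [|n IH] w.
  rewrite leqn0 => /eqP/len0 -> c g; rewrite mulg1 mul1g => ->; split=> // _ h hg.
  by rewrite mulg1 -[h]mul1g; apply: ceq_mulr.
move=> lw c g e; set X := supp c.
have wcw : dvl w (c * w) by rewrite e; apply: dvl_mulr.
have [x1|x1] := pselect (pre X w = 1); last first.
  have [w' ew] := pre_dvl X w; set x := pre X w in x1 ew.
  have xX : supp x \subset X by apply: supp_pre.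
  have [c1 ec1] : dvl x (c * x).
    apply: (@dvl_lred_mul X _ w') => //; first exact: (pre_lred ew).
      exact: supp_mul.
    by rewrite -mulgA -ew; apply: dvl_trans wcw; apply: pre_dvl.
  have e' : c1 * w' = w' * g.
    by apply: (canl (a := x)); rewrite mulgA -ec1 -mulgA -ew e mulgA -ew.
  have lw' : len w' <= n.
    have : 0 < len x by rewrite lt0n; apply/eqP => /len0.
    by move: lw; rewrite ew lenM; lia.
  have [h1 h2] := IH _ lw' _ _ e'.
  have c1X : supp c1 \subset X.
    by have [] : supp x \subset X /\ supp c1 \subset X by apply: supp_fac; rewrite -ec1; apply: supp_mul.
  have lc1 := subset_leq_card c1X.
  split; first exact: leq_trans h1 lc1.
  move=> h3 h hX.
  have ec1X : supp c1 = X by apply/eqP; rewrite eqEcard c1X (leq_trans h3).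
  have {}h2 : forall h, supp h \subset X -> ceq (supp g) (h * w') w'.
    by rewrite -ec1X; apply: h2; rewrite ec1X.
  rewrite ew mulgA; apply: (ceq_trans (b := w')); first by apply: h2; apply: supp_mul.
  by apply: ceq_sym; apply: h2.
have rw : lred X w.
  by apply: (@pre_lred X w w); rewrite x1 mul1g.
have [w1|w1] := pselect (w = 1).
  move: e; rewrite w1 mulg1 mul1g => ecg; rewrite /X ecg; split=> // _ h hg.
  by rewrite mulg1 -[h]mul1g; apply: ceq_mulr.
set u := meet w Delta; have [w' ew] : dvl u w by apply: meetl.
have su : simple u by apply/simpleP; apply: meetr.
have ru : lred X u by apply: lred_dvl rw; apply: meetl.
(* [u] divides [c * w], and also [c * Delta], a multiple of [Delta]; so it divides their meet
   [c * u]. *)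
have [c1 ec1] : dvl u (c * u).
  rewrite -meet_mul2l; apply: meet_max; first by apply: dvl_trans wcw; apply: meetl.
  by apply: dvl_trans (dvl_Delta_comm c); apply: meetr.
have e' : c1 * w' = w' * g.
  by apply: (canl (a := u)); rewrite mulgA -ec1 -mulgA -ew e mulgA -ew.
have lw' : len w' <= n.
  have : 0 < len u.
    rewrite lt0n; apply/eqP => /len0 u1; case: (atoml w) => // -[s [b eb]].
    have : dvl (gen s) u.
      apply: meet_max; first by rewrite eb; apply: dvl_mulr.
      by apply/simpleP; apply: simple_gen.
    by rewrite u1 => /dvl_len; rewrite len_gen len1.
  by move: lw; rewrite ew lenM; lia.
have [h1 h2] := IH _ lw' _ _ e'.
(* The complement of [c] divides [c1], which has the length of [c]; no length is gained, so every
   letter of [c] crosses [u]. *)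
have [_ []] := len_res_lred su ru (subxx X).
  have /res_dvl/dvl_len : dvl c (u * c1) by rewrite -ec1; apply: dvl_mulr.
  by move/leq_trans; apply; have := congr1 len ec1; rewrite !lenM; lia.
move=> _ lit.
have /choice[f hf] : forall t, exists t', t \in X -> gen t * u = u * gen t'.
  move=> t; have [tX|] := boolP (t \in X); last by exists t.
  by have [t' et'] := lit t tX; exists t'.
have cl := conj_letters hf.
have [c1' ec1' sc1] := cl c (subxx X).
have {ec1'} ec1' : c1' = c1 by apply: (canl (a := u)); rewrite -ec1' ec1.
rewrite ec1' in sc1.
have lc1 : #|supp c1| <= #|X| by rewrite sc1; apply: leq_imset_card.
split; first exact: leq_trans h1 lc1.
move=> h3 h hX; have [h' eh' sh'] := cl h hX.
rewrite ew mulgA eh' -mulgA; apply: ceq_mul2l; apply: h2; first exact: leq_trans lc1 h3.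
by rewrite sh' sc1; apply: imsetS.
Qed.

(** With [w * w' = Z ^+ n] one also has [g * w' = w' * c]; the two inequalities make the supports
    equal in size. *)
Lemma positive_conj c w g : c * w = w * g ->
  forall h, supp h \subset supp c -> ceq (supp g) (h * w) w.
Proof.
move=> e; have [w' [n ew]] := Zcomp w.
have [_] := positive_conj_supp e; apply.
have ew' : g * w' = w' * c.
  by apply: (canl (a := w)); rewrite mulgA -e -mulgA ew mulgA ew ZXcentral.
by have [] := positive_conj_supp ew'.
Qed.

(** * Common neighbours of two vertices *)

Lemma finite_len n : exists L : seq M, forall a, len a <= n -> a \in L.
Proof.
elim: n => [|n [L hL]].
  by exists [:: 1] => a; rewrite leqn0 => /eqP/len0 ->; rewrite inE.
exists (1 :: [seq gen s * b | s <- enum S, b <- L]) => a; rewrite inE.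
case: (atoml a) => [->|[s [b ->]]]; first by rewrite eqxx.
rewrite lenM len_gen add1n ltnS => /hL bL; apply/orP; right.
by apply: allpairs_f => //; rewrite mem_enum.
Qed.

Lemma ceq_supp T a h : ceq T (a * h) a -> supp h \subset T.
Proof.
rewrite /ceq => e; have [r ea _] := muE T a; have [r' eah r'T] := muE T (a * h).
have er : r * h = r' by apply: (canl (a := mu T a)); rewrite mulgA -ea -e.
by move: r'T; rewrite -er suppM subUset => /andP[].
Qed.

(** Source of the finiteness of the remainders: [Z ^+ k] is central, so [W] divides [c * Z ^+ k] and
    its complement divides [Z ^+ k], whatever [c] is. *)
Lemma shift_bound T W c k : dvl W (Z ^+ k) -> len (shift T W c) <= len (Z ^+ k).
Proof.
move=> h; apply: leq_trans (dvl_len (mu_dvl _ _)) _; apply: dvl_len.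
by apply/res_dvl; rewrite ZXcentral; apply: dvl_trans h (dvl_mulr _ _).
Qed.

Lemma supp_shift T W c X : supp W \subset X -> supp c \subset X -> supp (shift T W c) \subset X.
Proof.
move=> WX cX; apply: subset_trans (supp_dvl (mu_dvl _ _)) _; exact: supp_res.
Qed.

(* Once [gen t * k * W = W * g] with [g] supported on [T], the letter [t] of [gen t * k] is
   conjugated by [W] into the support of [g]. *)
Lemma ceq_gen_of_loop T W k t : rred T W -> ceq T (gen t * k * W) W -> ceq T (gen t * W) W.
Proof.
move=> rW e; have [g eg gT] := muE T (gen t * k * W).
rewrite e mu_id // in eg; apply: ceq_sub gT _; apply: (positive_conj eg).
by rewrite suppM subsetUl.
Qed.

Lemma ceq_gen_of_missing T W t : rred T W -> t \notin supp W -> below T W (gen t) ->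
  ceq T (gen t * W) W.
Proof.
move=> rW tW /(belowP _ rW) h; have ho := orth_of_missing rW tW h.
have [c e] : gen t * W = W * gen t /\ res (gen t) W = W.
  by apply: orth_comm => x /ho; rewrite /orth eq_sym adjC.
rewrite c; apply: ceq_mulr; move: h.
suff -> : res W (gen t) = gen t by [].
by apply: (canl (a := W)); rewrite res_comm e c.
Qed.

(* The base point moves by letters other than [c] until the pair of remainders is terminal for
   reachability; the loops through a terminal pair give the last clause.  The letter [c] itself is
   missing from the remainders, so it commutes with them when it is admissible. *)
Lemma terminal_base (T1 T2 : {set S}) (c : S) g1 g2 : ceq [set~ c] g1 g2 ->
  exists n W1 W2, [/\ ceq [set~ c] n g1, rred T1 W1 /\ rred T2 W2,
    ceq T1 (n * W1) g1 /\ ceq T2 (n * W2) g2,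
    supp W1 \subset [set~ c] /\ supp W2 \subset [set~ c] &
    forall t, below T1 W1 (gen t) -> below T2 W2 (gen t) ->
      ceq T1 (gen t * W1) W1 /\ ceq T2 (gen t * W2) W2].
Proof.
set T0 := [set~ c] => eg.
(* Starting at the meet, which stays in the common coset, makes [h1] and [h2] positive. *)
have e1 : ceq T0 (meet g1 g2) g1 by apply: ceq_meet.
have e2 : ceq T0 (meet g1 g2) g2 by apply: ceq_trans eg.
have [h1 eh1] := meetl g1 g2; have [h2 eh2] := meetr g1 g2.
set e := meet g1 g2 in e1 e2 eh1 eh2.
have h1T : supp h1 \subset T0 by apply: (@ceq_supp _ e); rewrite -eh1; apply: ceq_sym.
have h2T : supp h2 \subset T0 by apply: (@ceq_supp _ e); rewrite -eh2; apply: ceq_sym.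
(* [V'] is what [V] becomes once the base point has moved by [k]. Right-reducedness is an
   implication because [preorder_terminal] wants reflexivity on all pairs. *)
pose R (V V' : M * M) := exists k, [/\ supp k \subset T0, ceq T1 (k * V'.1) V.1,
  ceq T2 (k * V'.2) V.2, rred T1 V.1 -> rred T1 V'.1 & rred T2 V.2 -> rred T2 V'.2].
pose x := (mu T1 h1, mu T2 h2).
have rx1 : rred T1 x.1 by apply: mu_rred.
have rx2 : rred T2 x.2 by apply: mu_rred.
have [k1 [xk1 _]] := common_mult x.1 1; have [k2 [xk2 _]] := common_mult x.2 1.
have [L1 hL1] := finite_len (len (Z ^+ k1)); have [L2 hL2] := finite_len (len (Z ^+ k2)).
have [|V V' V'' [k [q1 q2 q3 q4 q5]] [k' [q1' q2' q3' q4' q5']]|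
  V [k [q1 q2 q3 q4 q5]]|[W1 W2] [k [kT k1W k2W r1 r2]] term] :=
  @preorder_terminal _ [seq (a, b) | a <- L1, b <- L2] R x.
- by move=> V; exists 1; rewrite supp1 sub0set !mul1g.
- exists (k * k'); split; auto; first exact: supp_mul.
    by rewrite -mulgA; apply: ceq_trans q2; apply: ceq_mul2l.
  by rewrite -mulgA; apply: ceq_trans q3; apply: ceq_mul2l.
- case: V => V1 V2 in q2 q3 q4 q5 *; apply: allpairs_f.
    by apply: hL1; rewrite -[V1](shift_uniq rx1 (q4 rx1) q2); apply: shift_bound.
  by apply: hL2; rewrite -[V2](shift_uniq rx2 (q5 rx2) q3); apply: shift_bound.
have {}r1 := r1 rx1; have {}r2 := r2 rx2; rewrite /= in k1W k2W r1 r2.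
have W1T : supp W1 \subset T0.
  rewrite -(shift_uniq rx1 r1 k1W); apply: supp_shift => //.
  exact: subset_trans (supp_dvl (mu_dvl _ _)) h1T.
have W2T : supp W2 \subset T0.
  rewrite -(shift_uniq rx2 r2 k2W); apply: supp_shift => //.
  exact: subset_trans (supp_dvl (mu_dvl _ _)) h2T.
exists (e * k), W1, W2; split=> //.
- by apply: ceq_trans e1; apply: ceq_mulr.
- split.
    rewrite eh1 -mulgA; apply: ceq_mul2l; apply: ceq_trans k1W _; exact: ceq_mu.
  rewrite eh2 -mulgA; apply: ceq_mul2l; apply: ceq_trans k2W _; exact: ceq_mu.
move=> t b1 b2; have [tc|tc] := eqVneq t c.
  have cW W : supp W \subset T0 -> t \notin supp W.
    by move=> h; apply/negP => /(subsetP h); rewrite !inE tc eqxx.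
  by split; apply: ceq_gen_of_missing => //; apply: cW.
have [|k' [_ /= q1 q2 _ _]] := term (shift T1 W1 (gen t), shift T2 W2 (gen t)).
  exists (gen t); split=> /=; try by [move=> _; apply: shift_rred|apply: shiftP].
  by rewrite supp_gen sub1set !inE.
split; apply: (@ceq_gen_of_loop _ _ k') => //; rewrite -mulgA.
  by apply: ceq_trans (shiftP r1 b1); apply: ceq_mul2l.
by apply: ceq_trans (shiftP r2 b2); apply: ceq_mul2l.
Qed.

Lemma ceq_gens T W X : (forall t, t \in X -> ceq T (gen t * W) W) ->
  forall k, supp k \subset X -> ceq T (k * W) W.
Proof.
move=> h k; elim: (len k) {-2}k (leqnn (len k)) => {k} [|n IH] k.
  by rewrite leqn0 => /eqP/len0 -> _; rewrite mul1g.
case: (atoml k) => [-> _ _|[t [k' ->]]]; first by rewrite mul1g.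
rewrite lenM len_gen add1n ltnS => lk /supp_fac[tX kX]; rewrite -mulgA.
apply: ceq_trans (h t _); first by apply: ceq_mul2l; apply: IH.
by apply: (subsetP tX); rewrite supp_gen inE.
Qed.

(** The first letter of [k] is admissible, so it fixes both cosets, and the rest of [k] satisfies
    the same hypotheses. *)
Lemma below_supp T1 T2 W1 W2 X :
  (forall t, t \in X -> ceq T1 (gen t * W1) W1 /\ ceq T2 (gen t * W2) W2) ->
  (forall t, below T1 W1 (gen t) -> below T2 W2 (gen t) -> t \in X) ->
  forall k, below T1 W1 k -> below T2 W2 k -> supp k \subset X.
Proof.
move=> h1 h2 k; elim: (len k) {-2}k (leqnn (len k)) => {k} [|n IH] k.
  by rewrite leqn0 => /eqP/len0 -> _ _; rewrite supp1 sub0set.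
case: (atoml k) => [-> _ _ _|[t [k' ->]]]; first by rewrite supp1 sub0set.
rewrite lenM len_gen add1n ltnS => lk b1 b2.
have tX : t \in X by apply: h2; [apply: below_dvl b1|apply: below_dvl b2]; apply: dvl_mulr.
apply: supp_mul; first by rewrite supp_gen sub1set.
have [q1 q2] := h1 t tX; apply: IH => //.
  by apply/(below_pmul T1 _ (gen t)); apply: below_ceq b1; apply: ceq_sym.
by apply/(below_pmul T2 _ (gen t)); apply: below_ceq b2; apply: ceq_sym.
Qed.

(* Two terminal base points have equal remainders, because the letters of their join are admissible
   from both. *)
Lemma common_base (T1 T2 : {set S}) (c d : S) a1 a2 g11 g12 g21 g22 :
  ceq T1 g11 a1 -> ceq T1 g12 a1 -> ceq T2 g21 a2 -> ceq T2 g22 a2 ->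
  ceq [set~ c] g11 g21 -> ceq [set~ d] g12 g22 ->
  exists n1 n2 W1 W2 al be (X : {set S}),
  [/\ ceq [set~ c] n1 g11, ceq [set~ d] n2 g12, ceq T1 (n1 * W1) a1, ceq T2 (n1 * W2) a2 &
  [/\ n1 * al = n2 * be, supp al \subset X /\ supp be \subset X,
    supp W1 \subset [set~ c] /\ supp W2 \subset [set~ c],
    rred T1 W1 /\ rred T2 W2 &
    forall t, t \in X -> below T1 W1 (gen t) /\ below T2 W2 (gen t)]].
Proof.
move=> e11 e12 e21 e22 ec ed.
have [n1 [W1 [W2 [q1 [r1 r2] [q2 q3] sW q4]]]] := terminal_base T1 T2 ec.
have [n2 [V1 [V2 [p1 [r1' r2'] [p2 p3] sV p4]]]] := terminal_base T1 T2 ed.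
pose X := [set t | `[< ceq T1 (gen t * W1) W1 /\ ceq T2 (gen t * W2) W2 >]].
pose Y := [set t | `[< ceq T1 (gen t * V1) V1 /\ ceq T2 (gen t * V2) V2 >]].
have hX t : t \in X -> ceq T1 (gen t * W1) W1 /\ ceq T2 (gen t * W2) W2.
  by rewrite inE => /asboolP.
have hY t : t \in Y -> ceq T1 (gen t * V1) V1 /\ ceq T2 (gen t * V2) V2.
  by rewrite inE => /asboolP.
have hX' t : below T1 W1 (gen t) -> below T2 W2 (gen t) -> t \in X.
  by move=> b1 b2; rewrite inE; apply/asboolP; apply: q4.
have hY' t : below T1 V1 (gen t) -> below T2 V2 (gen t) -> t \in Y.
  by move=> b1 b2; rewrite inE; apply/asboolP; apply: p4.
have nW1 : ceq T1 (n1 * W1) a1 by apply: ceq_trans e11.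
have nW2 : ceq T2 (n1 * W2) a2 by apply: ceq_trans e21.
have nV1 : ceq T1 (n2 * V1) a1 by apply: ceq_trans e12.
have nV2 : ceq T2 (n2 * V2) a2 by apply: ceq_trans e22.
(* Both cosets contain multiples of the join, so [al] and [be] consist of admissible letters. *)
have b1 : below T1 a1 (join n1 n2).
  apply: below_join; first by apply: (below_ceq nW1); exists (n1 * W1) => //; apply: dvl_mulr.
  by apply: (below_ceq nV1); exists (n2 * V1) => //; apply: dvl_mulr.
have b2 : below T2 a2 (join n1 n2).
  apply: below_join; first by apply: (below_ceq nW2); exists (n1 * W2) => //; apply: dvl_mulr.
  by apply: (below_ceq nV2); exists (n2 * V2) => //; apply: dvl_mulr.
have ej := resE n1 n2; have ej' := resE n2 n1; rewrite joinC in ej'.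
set al := res n1 n2 in ej; set be := res n2 n1 in ej'.
have alX : supp al \subset X.
  apply: (below_supp hX hX').
    by apply/(below_pmul T1 _ n1); rewrite ej; apply: below_ceq b1; apply: ceq_sym.
  by apply/(below_pmul T2 _ n1); rewrite ej; apply: below_ceq b2; apply: ceq_sym.
have beY : supp be \subset Y.
  apply: (below_supp hY hY').
    by apply/(below_pmul T1 _ n2); rewrite ej'; apply: below_ceq b1; apply: ceq_sym.
  by apply/(below_pmul T2 _ n2); rewrite ej'; apply: below_ceq b2; apply: ceq_sym.
have aW1 : ceq T1 (al * W1) W1 by apply: (@ceq_gens _ _ X) => // t /hX[].
have aW2 : ceq T2 (al * W2) W2 by apply: (@ceq_gens _ _ X) => // t /hX[].
have bV1 : ceq T1 (be * V1) V1 by apply: (@ceq_gens _ _ Y) => // t /hY[].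
have bV2 : ceq T2 (be * V2) V2 by apply: (@ceq_gens _ _ Y) => // t /hY[].
(* [al] and [be] fix the cosets of the remainders; seen from the join, the coset of [a1] has both
   [W1] and [V1] as right-reduced representative. *)
have WV1 : W1 = V1.
  apply: (@ceq_rred T1) => //; apply/(ceq_pmul T1 (join n1 n2)).
  rewrite -[in X in ceq _ X]ej -ej' -!mulgA.
  apply: (@ceq_trans _ _ (n1 * W1)); first exact: ceq_mul2l.
  apply: (ceq_trans nW1); apply: ceq_sym; apply: (ceq_trans _ nV1); exact: ceq_mul2l.
have WV2 : W2 = V2.
  apply: (@ceq_rred T2) => //; apply/(ceq_pmul T2 (join n1 n2)).
  rewrite -[in X in ceq _ X]ej -ej' -!mulgA.
  apply: (@ceq_trans _ _ (n1 * W2)); first exact: ceq_mul2l.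
  apply: (ceq_trans nW2); apply: ceq_sym; apply: (ceq_trans _ nV2); exact: ceq_mul2l.
exists n1, n2, W1, W2, al, be, X; split=> //; split=> //.
- by rewrite ej ej'.
- by split=> //; rewrite /X WV1 WV2.
move=> t /hX[h1 h2]; split.
  by apply: (below_ceq h1); exists (gen t * W1) => //; apply: dvl_mulr.
by apply: (below_ceq h2); exists (gen t * W2) => //; apply: dvl_mulr.
Qed.

Lemma orth_commute X Y x y : (forall s t, s \in X -> t \in Y -> orth s t) ->
  supp x \subset X -> supp y \subset Y -> x * y = y * x.
Proof.
move=> h; elim: (len x) {-2}x (leqnn (len x)) => {x} [|n IH] x.
  by rewrite leqn0 => /eqP/len0 -> _ _; rewrite mulg1 mul1g.
case: (atoml x) => [-> _ _ _|[s [x' ->]]]; first by rewrite mulg1 mul1g.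
rewrite lenM len_gen add1n ltnS => lx /supp_fac[sX xX] yY.
rewrite -mulgA IH // !mulgA; congr (_ * _); apply: (orth_comm _).1 => t ty.
by apply: h; [apply: (subsetP sX); rewrite supp_gen inE|apply: (subsetP yY)].
Qed.

Lemma orth_split X Y x : (forall s t, s \in X -> t \in Y -> orth s t) ->
  supp x \subset X :|: Y ->
  exists x1 x2, [/\ x = x1 * x2, supp x1 \subset X & supp x2 \subset Y].
Proof.
move=> h; elim: (len x) {-2}x (leqnn (len x)) => {x} [|n IH] x.
  by rewrite leqn0 => /eqP/len0 -> _; exists 1, 1; rewrite mulg1 supp1 !sub0set.
case: (atoml x) => [-> _ _|[s [x' ->]]]; first by exists 1, 1; rewrite mulg1 supp1 !sub0set.
rewrite lenM len_gen add1n ltnS => lx /supp_fac[sXY /IH[//|x1 [x2 [-> x1X x2Y]]]].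
have : s \in X :|: Y by apply: (subsetP sXY); rewrite supp_gen inE.
rewrite inE => /orP[sX|sY].
  exists (gen s * x1), x2; split=> //; first by rewrite mulgA.
  by apply: supp_mul => //; rewrite supp_gen sub1set.
have sY' : supp (gen s) \subset Y by rewrite supp_gen sub1set.
exists x1, (gen s * x2); split=> //; last exact: supp_mul.
by rewrite !mulgA (orth_commute h x1X sY').
Qed.

Lemma ceq_Z T n a b : ceq T a b -> ceq T (a * Z ^+ n) (b * Z ^+ n).
Proof. by rewrite !ZXcentral; apply: ceq_mul2l. Qed.

(* In the group of fractions, [n1 * y1 * y2^-1] lies in both cosets. *)
Lemma orth_cross X Y (T T' : {set S}) n1 n2 x1 x2 y1 y2 :
  (forall s t, s \in X -> t \in Y -> orth s t) ->
  supp x1 \subset X -> supp x2 \subset X -> supp y1 \subset Y -> supp y2 \subset Y ->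
  X \subset T' -> Y \subset T -> n1 * (x1 * y1) = n2 * (x2 * y2) ->
  exists e N, ceq T e (n1 * Z ^+ N) /\ ceq T' e (n2 * Z ^+ N).
Proof.
move=> h x1X x2X y1Y y2Y XT YT e; have [y2' [N ey]] := Zcomp y2.
exists (n1 * y1 * y2'), N.
have xy : x1 * y2 = y2 * x1 by apply: orth_commute x1X y2Y.
have xy1 : x1 * y1 = y1 * x1 by apply: orth_commute x1X y1Y.
have ey' : y2' * y2 = Z ^+ N.
  by apply: (canl (a := y2)); rewrite mulgA ey ZXcentral.
have xy' : x1 * y2' = y2' * x1.
  by apply: (canl (a := y2)); rewrite mulgA -xy -mulgA ey mulgA ey ZXcentral.
split; apply/ceqP.
  exists y2, y1; split; [exact: subset_trans YT|exact: subset_trans YT|].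
  by rewrite -mulgA ey' -!mulgA ZXcentral.
exists x1, x2; split; [exact: subset_trans XT|exact: subset_trans XT|].
have -> : n1 * y1 * y2' * x1 = n1 * (x1 * y1) * y2' by rewrite xy1 -!mulgA xy'.
by rewrite e -!mulgA ey ZXcentral.
Qed.

(** [g11], [g12] are common elements of x1 with y1 and y2, and [g21], [g22] those of x2. The path
    does not appear: the last clause concerns any letter [k] on the border of [C], and says that the
    coset of [n] of type [k] meets y1, y2, x1, x2, and equals x1 or x2 if it has the same type.
    Powers of [Z] clear the denominators of [orth_cross]. *)
Theorem separating_letters (a b c d : S) a1 a2 g11 g12 g21 g22 :
  ceq [set~ a] g11 a1 -> ceq [set~ a] g12 a1 -> ceq [set~ b] g21 a2 -> ceq [set~ b] g22 a2 ->
  ceq [set~ c] g11 g21 -> ceq [set~ d] g12 g22 ->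
  (exists e N, ceq [set~ c] e (g11 * Z ^+ N) /\ ceq [set~ d] e (g12 * Z ^+ N)) \/
  exists n (C : {set S}), [/\ c \in C, d \in C, a \notin C, b \notin C & forall k, k \notin C ->
    (exists2 r, r \in C & adjS k r) ->
    [/\ ceq [set~ c] n g11,
      exists e N, ceq [set~ k] e (n * Z ^+ N) /\ ceq [set~ d] e (g12 * Z ^+ N),
      exists2 e, ceq [set~ k] e n & ceq [set~ a] e a1,
      exists2 e, ceq [set~ k] e n & ceq [set~ b] e a2 &
      (k = a -> ceq [set~ k] n a1) /\ (k = b -> ceq [set~ k] n a2)]].
Proof.
move=> e11 e12 e21 e22 ec ed.
have [n1 [n2 [W1 [W2 [al [be [X [q1 q2 q3 q4 [q5 [alX beX] [sW1 sW2] [r1 r2] hX]]]]]]]]] :=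
  common_base e11 e12 e21 e22 ec ed.
pose R : rel S := fun s t => [&& s \in X, t \in X & adjS s t].
pose C := [set t in X | (c \in X) && connect R c t].
have CX : C \subset X by apply/subsetP => t; rewrite inE => /andP[].
have hO s t : s \in C -> t \in X :\: C -> orth s t.
  rewrite !inE => /andP[sX /andP[cX cs]] /andP[nt tX].
  rewrite tX cX /= in nt; apply/andP; split; first by apply: contraNneq nt => <-.
  apply: contraNN nt => ad; apply: connect_trans cs (connect1 _).
  by rewrite /R sX tX.
have hO' s t : s \in X :\: C -> t \in C -> orth s t.
  by move=> sD tC; have := hO t s tC sD; rewrite /orth eq_sym adjC.
have XE : X \subset C :|: X :\: C by apply/subsetP => t tX; rewrite !inE tX; case: (_ && _).
have [al1 [al2 [eal al1C al2D]]] := orth_split hO (subset_trans alX XE).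
have [be1 [be2 [ebe be1C be2D]]] := orth_split hO (subset_trans beX XE).
have sT k (A : {set S}) : k \notin A -> A \subset [set~ k].
  by move=> kA; apply/subsetP => t tA; rewrite !inE; apply: contraNneq kA => <-.
have cD : c \notin X :\: C.
  by rewrite !inE; case cX: (c \in X); rewrite ?andbF //= connect0.
have e : n1 * (al1 * al2) = n2 * (be1 * be2) by rewrite -eal -ebe.
have [dC|dC] := boolP (d \in C); last first.
  left; have [x [N [h1 h2]]] := orth_cross hO al1C be1C al2D be2D (sT _ _ dC) (sT _ _ cD) e.
  by exists x, N; split; [apply: ceq_trans h1 _|apply: ceq_trans h2 _]; apply: ceq_Z.
have cX : c \in X by move: dC; rewrite inE => /andP[_ /andP[]].
have cC : c \in C by rewrite inE cX connect0.
have dD : d \notin X :\: C by rewrite inE dC.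
(* The remainders avoid [c], and this spreads over [C]: all letters of [W] commute with an
   admissible letter that [W] avoids, so [W] avoids its neighbours as well. *)
have missing T W : rred T W -> (forall t, t \in X -> below T W (gen t)) ->
  supp W \subset [set~ c] -> forall t, t \in C -> t \notin supp W.
  move=> rW bW sW t; rewrite inE => /andP[_ /andP[_ /connectP[p pth ->]]].
  have : c \notin supp W by apply/negP => /(subsetP sW); rewrite !inE eqxx.
  elim: p {1 2 3}c pth => //= t' p IH s /andP[/and3P[sX tX ad] pth] sW'.
  apply: IH => //; apply: contraL ad => t'W.
  have := orth_of_missing rW sW' ((belowP _ rW).1 (bW _ sX)) t'W.
  by rewrite adjC => /andP[].
have b1 t : t \in X -> below [set~ a] W1 (gen t) by case/hX.
have b2 t : t \in X -> below [set~ b] W2 (gen t) by case/hX.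
have m1 := missing _ _ r1 b1 sW1; have m2 := missing _ _ r2 b2 sW2.
have red1 T W : rred T W -> supp W \subset T -> W = 1.
  by move=> rW sW; apply: (@rredP T W 1 W); rewrite ?mul1g.
(* If [s] were in [C], [W] would avoid [s], hence be trivial, and some element avoiding [s] would be
   a multiple of [s]. *)
have notC s W : rred [set~ s] W -> (forall t, t \in X -> below [set~ s] W (gen t)) ->
  (forall t, t \in C -> t \notin supp W) -> s \notin C.
  move=> rW bW mW; apply/negP => sC.
  have W0 := red1 _ _ rW (sT _ _ (mW s sC)).
  have := (belowP _ rW).1 (bW s (subsetP CX s sC)).
  by rewrite W0 res1l supp_gen sub1set !inE eqxx.
have kW s W k : rred [set~ s] W -> (forall t, t \in X -> below [set~ s] W (gen t)) ->
  (forall t, t \in C -> t \notin supp W) -> (exists2 r, r \in C & adjS k r) -> k \notin supp W.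
  move=> rW bW mW [r rC ad]; apply: contraL ad => kW.
  by have /andP[] := orth_of_missing rW (mW r rC) ((belowP _ rW).1 (bW _ (subsetP CX r rC))) kW.
right; exists n1, C; split=> //; [exact: notC r1 b1 m1|exact: notC r2 b2 m2|].
move=> k kC kr.
have k1 := kW _ _ _ r1 b1 m1 kr; have k2 := kW _ _ _ r2 b2 m2 kr.
split=> //.
- have e' : n1 * (al2 * al1) = n2 * (be2 * be1).
    by rewrite -(orth_commute hO al1C al2D) -(orth_commute hO be1C be2D).
  have [x [N [h1 h2]]] := orth_cross hO' al2D be2D al1C be1C (sT _ _ dD) (sT _ _ kC) e'.
  by exists x, N; split=> //; apply: ceq_trans h2 _; apply: ceq_Z.
- by exists (n1 * W1) => //; apply: ceq_mulr; apply: sT.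
- by exists (n1 * W2) => //; apply: ceq_mulr; apply: sT.
split=> ek.
  have W0 : W1 = 1 by apply: red1 r1 _; rewrite -ek; apply: sT.
  by rewrite ek; move: q3; rewrite W0 mulg1.
have W0 : W2 = 1 by apply: red1 r2 _; rewrite -ek; apply: sT.
by rewrite ek; move: q4; rewrite W0 mulg1.
Qed.
End Garside.

(** * Monoids presented by words and relations *)

Section Presentation.
Variables (T : choiceType) (E : seq T -> seq T -> Prop).

Inductive congr_gen : seq T -> seq T -> Prop :=
| congr_refl w : congr_gen w w
| congr_sym w1 w2 : congr_gen w1 w2 -> congr_gen w2 w1
| congr_trans w1 w2 w3 : congr_gen w1 w2 -> congr_gen w2 w3 -> congr_gen w1 w3
| congr_step u a b v : E a b -> congr_gen (u ++ a ++ v) (u ++ b ++ v).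

Lemma congr_ctx x y u v : congr_gen u v -> congr_gen (x ++ u ++ y) (x ++ v ++ y).
Proof.
elim=> [w|w1 w2 _|w1 w2 w3 _ h1 _|w a b w' e].
- exact: congr_refl.
- exact: congr_sym.
- exact: congr_trans.
by have := congr_step (x ++ w) (w' ++ y) e; rewrite -!catA.
Qed.

Lemma congr_cat u u' v v' : congr_gen u u' -> congr_gen v v' -> congr_gen (u ++ v) (u' ++ v').
Proof.
move=> h1 h2; apply: (congr_trans (w2 := u' ++ v)); first exact: (congr_ctx [::] v h1).
by have := congr_ctx u' [::] h2; rewrite !cats0.
Qed.

(** Choosing one word in each class makes the quotient a subtype of the words, with Leibniz
    equality. *)
Definition canon (w : seq T) := choose (fun v => `[< congr_gen w v >]) w.

Lemma canon_congr w : congr_gen w (canon w).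
Proof.
by have /asboolP := @chooseP _ (fun v => `[< congr_gen w v >]) w (asboolT (congr_refl w)).
Qed.

Lemma eq_canon w w' : congr_gen w w' -> canon w = canon w'.
Proof.
move=> e; rewrite /canon.
have eP : (fun v => `[< congr_gen w v >]) =1 (fun v => `[< congr_gen w' v >]).
  move=> v; apply/asboolP/asboolP => h; apply: congr_trans h => //; exact: congr_sym.
rewrite (eq_choose eP); apply: choose_id; apply/asboolP; first exact: congr_sym.
exact: congr_refl.
Qed.

Lemma canon_id w : canon (canon w) == canon w.
Proof. by apply/eqP; apply: eq_canon; apply: congr_sym; apply: canon_congr. Qed.

Record quot := Quot { qrep : seq T; qrepP : canon qrep == qrep }.
HB.instance Definition _ := [isSub for qrep].
HB.instance Definition _ := [Choice of quot by <:].

Definition cls w : quot := Quot (canon_id w).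

Lemma clsP w w' : cls w = cls w' <-> congr_gen w w'.
Proof.
split=> [/(congr1 qrep)/= e|/eq_canon e]; last exact: val_inj.
by apply: congr_trans (canon_congr w) _; rewrite e; apply: congr_sym; apply: canon_congr.
Qed.

Lemma qrepK q : cls (qrep q) = q.
Proof. by apply: val_inj; apply/eqP; apply: qrepP. Qed.

Definition qmul q q' := cls (qrep q ++ qrep q').
Definition qone := cls [::].

Lemma cls_cat u v : cls (u ++ v) = qmul (cls u) (cls v).
Proof. by apply/clsP; apply: congr_cat; apply: canon_congr. Qed.

Lemma qmulA : associative qmul.
Proof.
by move=> x y z; rewrite -(qrepK x) -(qrepK y) -(qrepK z) -!cls_cat catA.
Qed.
Lemma qmul1 : left_id qone qmul.
Proof. by move=> x; rewrite -(qrepK x) -cls_cat. Qed.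
Lemma qmulr1 : right_id qone qmul.
Proof. by move=> x; rewrite -(qrepK x) -cls_cat cats0. Qed.
HB.instance Definition _ := isMonoid.Build quot qmulA qmul1 qmulr1.

Lemma clsM u v : cls (u ++ v) = cls u * cls v. Proof. exact: cls_cat. Qed.
Lemma cls_cons x u : cls (x :: u) = cls [:: x] * cls u. Proof. by rewrite -clsM. Qed.
End Presentation.

(** * Alternating words *)

Definition altw (S : Type) (s t : S) n : seq S := mkseq (fun i => if odd i then t else s) n.

Lemma size_altw (S : Type) (s t : S) n : size (altw s t n) = n. Proof. exact: size_mkseq. Qed.

Lemma altwS (S : Type) (s t : S) n : altw s t n.+1 = s :: altw t s n.
Proof.
rewrite /altw /mkseq /=; congr (_ :: _); rewrite (iotaDl 1 0) -map_comp.
by apply: eq_map => i /=; case: (odd i).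
Qed.

Lemma altw_cat (S : Type) (s t : S) a b :
  altw s t (a + b) = altw s t a ++ (if odd a then altw t s b else altw s t b).
Proof.
elim: a s t => [|a IH] s t //; rewrite addSn !altwS IH /=.
by case: (odd a).
Qed.

Lemma rev_altw (S : Type) (s t : S) n : rev (altw s t n) = if odd n then altw s t n else altw t s n.
Proof.
elim: n s t => [|n IH] s t //; rewrite altwS rev_cons IH -cats1 /=.
by case on : (odd n); rewrite /= -?altwS -[n.+1]addn1 altw_cat on.
Qed.

(** * Coxeter groups by generators and relations *)

Section Coxeter.
Variables (S : finType) (m : S -> S -> nat).

Definition braid (a b : seq S) : Prop :=
  exists s t, [/\ s != t, a = altw s t (m s t) & b = altw t s (m s t)].
Definition cox (a b : seq S) : Prop := braid a b \/ exists s, a = [:: s; s] /\ b = [::].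

Definition coxg : Type := quot cox.
HB.instance Definition _ := Monoid.on coxg.
Definition wv (u : seq S) : coxg := cls cox u.

Lemma wvM u v : wv (u ++ v) = wv u * wv v. Proof. exact: clsM. Qed.
Lemma wv_cons s u : wv (s :: u) = wv [:: s] * wv u. Proof. exact: cls_cons. Qed.
Lemma wv0 : wv [::] = 1. Proof. by []. Qed.
Lemma wvss s : wv [:: s] * wv [:: s] = 1.
Proof.
rewrite -wvM; apply/clsP; apply: (congr_step [::] [::] (a := [:: s; s]) (b := [::])).
by right; exists s.
Qed.

Definition cinv (w : coxg) : coxg := wv (rev (qrep w)).
Lemma wv_rev u : wv (rev u) * wv u = 1.
Proof.
elim: u => [|s u IH]; first by rewrite wv0 mulg1.
by rewrite rev_cons -cats1 wvM (wv_cons s u) -mulgA (mulgA (wv [:: s])) wvss mul1g.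
Qed.
Lemma cmulVg : left_inverse 1 cinv *%g.
Proof. by move=> w; rewrite -[X in _ * X](qrepK w); apply: wv_rev. Qed.
Lemma cmulgV : right_inverse 1 cinv *%g.
Proof.
by move=> w; rewrite -[X in X * _](qrepK w) /cinv; have := wv_rev (rev (qrep w)); rewrite revK.
Qed.
HB.instance Definition _ := hasInv.Build coxg cinv.
HB.instance Definition _ := Monoid_isGroup.Build coxg cmulVg cmulgV.

Lemma wvV u : (wv u)^-1 = wv (rev u).
Proof. by apply: (mulIg (wv u)); rewrite mulVg wv_rev. Qed.
Lemma wv_genV s : (wv [:: s])^-1 = wv [:: s]. Proof. exact: wvV. Qed.


Lemma wv_braid s t : s != t -> wv (altw s t (m s t)) = wv (altw t s (m s t)).
Proof.
move=> st; apply/clsP.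
have := @congr_step _ cox [::] (altw s t (m s t)) (altw t s (m s t)) [::].
by rewrite /= !cats0; apply; left; exists s, t.
Qed.

(** * Reflections and the exchange property *)

(** For [u = s_1 ... s_n], the reflections [s_1 ... s_i ... s_1]: multiplying on the left by the
    i-th one deletes the letter [s_i]. *)
Fixpoint refls (u : seq S) : seq coxg :=
  if u is s :: u' then wv [:: s] :: [seq t ^ wv [:: s] | t <- refls u'] else [::].

Lemma size_refls u : size (refls u) = size u.
Proof. by elim: u => //= s u IH; rewrite size_map IH. Qed.

Lemma refls_cat u v : refls (u ++ v) = refls u ++ [seq t ^ (wv u)^-1 | t <- refls v].
Proof.
elim: u => [|s u IH] /=; first by rewrite (eq_map (g := id)) ?map_id // => t; rewrite wv0 invg1 conjg1.
rewrite IH map_cat -map_comp; congr (_ :: (_ ++ _)); apply: eq_map => t /=.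
by rewrite (wv_cons s u) invgM conjgM wv_genV.
Qed.

Lemma refls_nth u i s0 : i < size u ->
  nth 1 (refls u) i = wv [:: nth s0 u i] ^ (wv (take i u))^-1.
Proof.
elim: u i => //= s u IH [|i] /=; first by rewrite wv0 invg1 conjg1.
rewrite ltnS => h; rewrite (nth_map 1) ?size_refls // IH //.
by rewrite (wv_cons s (take i u)) invgM conjgM wv_genV.
Qed.

Definition del i (u : seq S) := take i u ++ drop i.+1 u.
Lemma size_del i u : i < size u -> (size (del i u)).+1 = size u.
Proof. by move=> h; rewrite /del size_cat size_take size_drop h; lia. Qed.

Lemma refls_del u i : i < size u -> nth 1 (refls u) i * wv u = wv (del i u).
Proof.
case: u => // s0 u' h; set u := s0 :: u' in h *; rewrite (refls_nth s0) // /del wvM.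
rewrite -[X in _ * wv X = _](cat_take_drop i u) (drop_nth s0 h) wvM (wv_cons _ (drop i.+1 u)).
set x := wv (take i u); set z := wv [:: nth s0 u i].
have zz : z * z = 1 by apply: wvss.
by rewrite conjgE invgK !mulgA mulgVK -(mulgA x) zz mulg1.
Qed.

Lemma refl_invol u (t : coxg) : t \in refls u -> t * t = 1.
Proof.
case/(nthP 1) => i; rewrite size_refls => h <-; case: u h => // s0 u' h.
by rewrite (refls_nth s0) // -conjMg wvss conj1g.
Qed.

(** The reflection cocycle modulo 2. The list of reflections depends on the word, but these parities
    only on the group element ([congr_par]). *)
Definition par u (t : coxg) := odd (count_mem t (refls u)).

Lemma par_cat u v (t : coxg) : par (u ++ v) t = par u t (+) par v (t ^ wv u).
Proof.
rewrite /par refls_cat count_cat oddD; congr (_ (+) odd _).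
rewrite count_map; apply: eq_count => x /=.
by apply/eqP/eqP => [<-|->]; rewrite ?conjgK ?conjgKV.
Qed.

Lemma wv_altw_add s t a b : wv (altw s t (a + b)) =
  wv (altw s t a) * (if odd a then wv (altw t s b) else wv (altw s t b)).
Proof. by rewrite altw_cat wvM; case: (odd a). Qed.

Lemma refls_altw s t n : refls (altw s t n) = mkseq (fun i => wv (altw s t i.*2.+1)) n.
Proof.
elim: n s t => [|n IH] s t //; rewrite altwS /= IH.
rewrite /mkseq /= (iotaDl 1 0) -!map_comp; congr (_ :: _).
apply: eq_map => i /=; rewrite conjgE wv_genV.
have -> : altw s t (i.+1).*2.+1 = [:: s] ++ (altw t s i.*2.+1 ++ [:: s]).
  by rewrite altwS doubleS -[in LHS]addn1 altw_cat /= odd_double.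
by rewrite !wvM.
Qed.

Lemma wv_altwV s t n : (wv (altw s t n))^-1 = if odd n then wv (altw s t n) else wv (altw t s n).
Proof. by rewrite wvV rev_altw; case: (odd n). Qed.

Lemma wv_altw_2m s t : s != t -> wv (altw s t (m s t + m s t)) = 1.
Proof.
move=> st; rewrite wv_altw_add; have := wv_altwV s t (m s t).
have := wv_braid st; case: ifP => _ e h; first by rewrite -e -{1}h mulVg.
by rewrite {2}e -h mulgV.
Qed.

Lemma wv_altw_compl s t k : s != t -> odd k -> k <= m s t + m s t ->
  wv (altw s t k) = wv (altw t s (m s t + m s t - k)).
Proof.
move=> st ok le; have := wv_altw_2m st; rewrite -{1}(subnKC le) wv_altw_add ok.
move/(canRL (mulgK _)); rewrite mul1g wv_altwV oddB // oddD addbb ok /=.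
by [].
Qed.

(** Since [(s t)^m = 1], an alternating word of odd length [k] has the value of the one of length
    [2 m - k] starting with the other letter: the two sides of a braid relation meet the same
    reflections in opposite order. *)
Lemma refls_braid s t : s != t -> refls (altw t s (m s t)) = rev (refls (altw s t (m s t))).
Proof.
move=> st; rewrite !refls_altw; apply: (@eq_from_nth _ 1); first by rewrite size_rev !size_mkseq.
move=> i; rewrite size_mkseq => h; rewrite nth_rev ?size_mkseq // !nth_mkseq //; last by lia.
rewrite (wv_altw_compl st) /= ?odd_double //; last by lia.
by congr (wv (altw _ _ _)); lia.
Qed.

Lemma congr_par u v : congr_gen cox u v -> forall t, par u t = par v t.
Proof.
elim=> [//|w1 w2 _ h t|w1 w2 w3 _ h1 _ h2 t|w a b w' e t]; [by rewrite h|by rewrite h1|].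
rewrite !par_cat; have -> : wv a = wv b.
  by apply/clsP; have := congr_step [::] [::] e; rewrite /= !cats0.
congr (_ (+) (_ (+) _)); case: e => [[x [y [xy -> ->]]]|[x [-> ->]]].
  by rewrite /par refls_braid // count_rev.
have e2 : refls [:: x; x] = [:: wv [:: x]; wv [:: x]] by rewrite /= conjgE mulKg.
by rewrite /par e2 /= addn0 addnn odd_double.
Qed.

Definition Par (w t : coxg) := par (qrep w) t.
Lemma Par_wv u (t : coxg) : Par (wv u) t = par u t.
Proof. by apply: congr_par; apply: congr_sym; apply: canon_congr. Qed.

Lemma wvK (w : coxg) : wv (qrep w) = w. Proof. exact: qrepK. Qed.

Lemma ParM (w w' t : coxg) : Par (w * w') t = Par w t (+) Par w' (t ^ w).
Proof.
have -> : w * w' = wv (qrep w ++ qrep w') by rewrite wvM !wvK.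
by rewrite Par_wv par_cat wvK.
Qed.

Definition has_word (w : coxg) n := `[< exists2 u, size u = n & wv u = w >].
Lemma has_word_ex w : exists n, has_word w n.
Proof. by exists (size (qrep w)); apply/asboolP; exists (qrep w) => //; apply: qrepK. Qed.
Definition clen (w : coxg) := ex_minn (has_word_ex w).

Lemma clen_le u : clen (wv u) <= size u.
Proof. by rewrite /clen; case: ex_minnP => n _; apply; apply/asboolP; exists u. Qed.
Lemma reduced_ex (w : coxg) : exists2 u, size u = clen w & wv u = w.
Proof. by rewrite /clen; case: ex_minnP => n /asboolP. Qed.

Lemma clenM_le (w w' : coxg) : clen (w * w') <= clen w + clen w'.
Proof.
have [u <- eu] := reduced_ex w; have [v <- ev] := reduced_ex w'.
by rewrite -{1}eu -{1}ev -wvM (leq_trans (clen_le _)) // size_cat.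
Qed.
Lemma clenV (w : coxg) : clen w^-1 = clen w.
Proof.
have h x : clen x^-1 <= clen x.
  by have [u <- <-] := reduced_ex x; rewrite wvV -size_rev clen_le.
by apply/eqP; rewrite eqn_leq h -{1}(invgK w) h.
Qed.
Lemma clen1 : clen 1 = 0%N.
Proof. by apply/eqP; rewrite -leqn0 -wv0 clen_le. Qed.
Lemma clen_eq0 (w : coxg) : clen w = 0%N -> w = 1.
Proof. by have [u <- <-] := reduced_ex w => /size0nil ->. Qed.

(** Multiplying twice by a repeated reflection deletes two letters without changing the element. *)
Lemma uniq_refls u : clen (wv u) = size u -> uniq (refls u).
Proof.
move=> hu; apply/(uniqP 1) => i j; rewrite !inE size_refls => iu ju.
wlog ij : i j iu ju / i < j.
  move=> hw e; case: (ltngtP i j) => // h; first exact: hw.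
  by apply/esym/hw.
move=> e; exfalso.
have iu' : i < size (del j u) by have := size_del ju; lia.
have ei : nth 1 (refls (del j u)) i = nth 1 (refls u) i.
  case: u ju {iu hu e iu'} => // s0 u' ju; rewrite !(refls_nth s0).
  - rewrite /del nth_cat size_take ju ij; congr (wv [:: _] ^ (wv _)^-1).
      by rewrite nth_take.
    by rewrite take_cat size_take ju ij take_takel // ltnW.
  - exact: ltn_trans ju.
  by have := size_del ju; lia.
have : wv (del i (del j u)) = wv u.
  rewrite -refls_del // -refls_del // ei e mulgA (@refl_invol u) ?mul1g //.
  by apply: mem_nth; rewrite size_refls.
move=> h; have := clen_le (del i (del j u)); rewrite h hu.
by have := size_del ju; have := size_del iu'; lia.
Qed.

(** Distinct reflections have odd parity, so each occurs along every word for the same element,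
    which is then at least as long. *)
Lemma reduced_uniq u : uniq (refls u) -> clen (wv u) = size u.
Proof.
move=> uu; apply/eqP; rewrite eqn_leq clen_le /=.
have [v <- ev] := reduced_ex (wv u); rewrite -(size_refls u) -(size_refls v).
apply: uniq_leq_size => // t tu; rewrite -has_pred1 has_count lt0n.
have : par v t by rewrite -Par_wv ev Par_wv /par count_uniq_mem // tu.
by rewrite /par; case: count.
Qed.

Lemma Par_del u (t : coxg) : Par (wv u) t -> exists2 i, i < size u & t * wv u = wv (del i u).
Proof.
rewrite Par_wv => h; have : t \in refls u.
  by rewrite -has_pred1 has_count lt0n; move: h; rewrite /par; case: count.
case/(nthP 1) => i; rewrite size_refls => iu <-; exists i => //; exact: refls_del.
Qed.

Lemma Par_clen (w t : coxg) : Par w t -> clen (t * w) < clen w.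
Proof.
have [u <- <-] := reduced_ex w => /Par_del[i iu ->].
by rewrite -(size_del iu) ltnS clen_le.
Qed.

Notation g s := (wv [:: s]).

Lemma clen_gen_le s (w : coxg) : clen (g s * w) <= (clen w).+1.
Proof. by apply: leq_trans (clenM_le _ _) _; rewrite -add1n leq_add2r (clen_le [:: s]). Qed.

Lemma Par_gen s t : Par (g s) t = (t == g s).
Proof. by rewrite Par_wv /par /= addn0 eq_sym; case: eqP. Qed.

Lemma clen_gen s (w : coxg) : clen (g s * w) = if Par w (g s) then (clen w).-1 else (clen w).+1.
Proof.
have h1 := clen_gen_le s w; have h2 := clen_gen_le s (g s * w).
rewrite mulgA wvss mul1g in h2.
case: ifP => h; first by have h3 := Par_clen h; lia.
have : Par (g s * w) (g s) by rewrite ParM Par_gen eqxx conjgE mulKg h.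
by move/Par_clen; rewrite mulgA wvss mul1g; lia.
Qed.
End Coxeter.

(** * The order of a product of two generators *)

Section DualRepresentation.
Variables (S : finType) (m : S -> S -> nat).
Hypothesis mC : forall s t, m s t = m t s.
Hypothesis m2 : forall s t, s != t -> 2 <= m s t.
Import GRing.Theory.
Local Open Scope ring_scope.

(** Any primitive root will do: only its order enters the computation of the order of [s t]. *)
Definition zeta n : algC :=
  if pselect (0 < n)%N is left n0 then sval (C_prim_root_exists n0) else 0.
Lemma zetaP n : (0 < n)%N -> n.-primitive_root (zeta n).
Proof. by move=> n0; rewrite /zeta; case: pselect => // h; case: (C_prim_root_exists h). Qed.

(* [-2 cos (pi / m s t)], written with a root of unity *)
Definition cartan s t : algC :=
  if s == t then 2 else - (zeta (m s t).*2 + (zeta (m s t).*2)^-1).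

(* The action of a generator on the linear forms on the space of roots *)
Definition dact s (f : S -> algC) : S -> algC := fun r => f r - cartan s r * f s.
Definition dactw (u : seq S) f := foldr dact f u.

Lemma dact_invol s f : dact s (dact s f) = f.
Proof. by apply: funext => r; rewrite /dact /cartan eqxx; ring. Qed.

Lemma dactw_cat u v f : dactw (u ++ v) f = dactw u (dactw v f).
Proof. exact: foldr_cat. Qed.

Lemma dactw_rev u f : dactw (rev u) (dactw u f) = f.
Proof.
elim: u => //= s u IH; rewrite rev_cons -cats1 dactw_cat /=.
by rewrite dact_invol.
Qed.

Lemma dactw_altw s t k f : dactw (altw s t k.*2) f = iter k (dact s \o dact t) f.
Proof. by elim: k => // k IH; rewrite doubleS !altwS /= IH. Qed.

Section Dihedral.
Variables (s t : S).
Hypothesis st : s != t.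
Let z := zeta (m s t).*2.
Let al := cartan s t.
Let Dst := dact s \o dact t.

Let m0 : (0 < m s t)%N. Proof. by have := m2 st; case: m. Qed.
Let zprim : (m s t).*2.-primitive_root z.
Proof. by apply: zetaP; rewrite double_gt0. Qed.
Let z0 : z != 0. Proof.
apply/eqP => e; have := prim_expr_order zprim; rewrite e expr0n double_eq0.
by case: (m s t) m0 => // n _ /esym/eqP; rewrite oner_eq0.
Qed.
Let zz : z - z^-1 != 0.
Proof.
rewrite subr_eq0; apply/eqP => e; have : z ^+ 2 = 1 by rewrite expr2 {2}e divff.
move/eqP; rewrite -(prim_order_dvd zprim) => /dvdn_leq.
by move/(_ isT); have := m2 st; lia.
Qed.
Let alE : al = - (z + z^-1). Proof. by rewrite /al /cartan (negbTE st). Qed.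
Let alE' : cartan t s = al. Proof. by rewrite /al /cartan eq_sym (negbTE st) mC. Qed.
Let css : cartan s s = 2. Proof. by rewrite /cartan eqxx. Qed.
Let ctt : cartan t t = 2. Proof. by rewrite /cartan eqxx. Qed.

(** For [y = z] and [y = z^-1], an eigenfunctional of the action of [s t] with eigenvalue [y ^+ 2];
    together the two determine [f s] and [f t]. *)
Let L (y : algC) (f : S -> algC) := f s + y * f t.

Let L_Dst f : L z (Dst f) = z ^+ 2 * L z f /\ L z^-1 (Dst f) = z^-1 ^+ 2 * L z^-1 f.
Proof. by rewrite /L /Dst /= /dact css ctt -/al alE' alE; split; field. Qed.

Let L_iter k f : L z (iter k Dst f) = z ^+ k.*2 * L z f /\
  L z^-1 (iter k Dst f) = z^-1 ^+ k.*2 * L z^-1 f.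
Proof.
elim: k => [|k [h1 h2]]; first by rewrite !mul1r.
rewrite iterS; have [-> ->] := L_Dst (iter k Dst f).
by rewrite h1 h2 doubleS -[k.*2.+2]addn2 !exprD; split; rewrite mulrCA mulrA.
Qed.

Let Dst_order f : iter (m s t) Dst f = f.
Proof.
 have [h1 h2] := L_iter (m s t) f.
rewrite (prim_expr_order zprim) mul1r in h1.
rewrite exprVn (prim_expr_order zprim) invr1 mul1r in h2.
set f' := iter _ _ f in h1 h2 *.
have ht : f' t = f t.
  apply: (mulfI zz); move: h1 h2; rewrite /L; move: (f' s) (f' t) (z^-1) => x' y' y h1 h2.
  transitivity ((x' + z * y') - (x' + y * y')); first by ring.
  by rewrite h1 h2; ring.
have hs : f' s = f s by move: h1; rewrite /L ht => /addIr.
apply: funext => r.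
(* [la] and [mu] solve the linear system, of determinant [det], saying that [psi] is invariant under
   [s] and [t]; the value at [r] then follows from [psi] and the values at [s] and [t]. *)
pose det := 4 - al ^+ 2.
have det0 : det != 0.
  have -> : det = - (z - z^-1) ^+ 2 by rewrite /det alE; field.
  by rewrite oppr_eq0 expf_neq0.
pose la := (al * cartan t r - 2 * cartan s r) / det.
pose mu := (al * cartan s r - 2 * cartan t r) / det.
pose psi (h : S -> algC) := h r + la * h s + mu * h t.
have psis h : psi (dact s h) = psi h.
  by rewrite /psi /dact css -/al /la /mu /det; field; exact: det0.
have psit h : psi (dact t h) = psi h.
  by rewrite /psi /dact ctt alE' /la /mu /det; field; exact: det0.
have : psi f' = psi f.
  rewrite /f'; elim: (m s t) => // k IH.
  by rewrite iterS /Dst /= psis psit.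
by rewrite /psi hs ht => /addIr/addIr.
Qed.

Lemma dactw_braid f : dactw (altw s t (m s t)) f = dactw (altw t s (m s t)) f.
Proof.
have e : dactw (altw s t (m s t) ++ rev (altw t s (m s t))) = id.
  rewrite rev_altw -altw_cat addnn; apply: funext => h.
  by rewrite dactw_altw -/Dst Dst_order.
have := congr1 (fun F => F (dactw (altw t s (m s t)) f)) e.
by rewrite /= dactw_cat dactw_rev.
Qed.

Lemma dactw_order k : (forall f, dactw (altw s t k.*2) f = f) -> (m s t %| k)%N.
Proof.
move=> h; pose f := fun r => (r == s)%:R : algC.
have [+ _] := L_iter k f; rewrite -/Dst -dactw_altw h /L /f eqxx eq_sym (negbTE st).
rewrite mulr0 addr0 mulr1 => /esym/eqP; rewrite -(prim_order_dvd zprim).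
by rewrite -!muln2 dvdn_pmul2r.
Qed.
End Dihedral.

Lemma congr_dactw u v : congr_gen (cox m) u v -> forall f, dactw u f = dactw v f.
Proof.
elim=> [//|w1 w2 _ h f|w1 w2 w3 _ h1 _ h2 f|w a b w' e f]; [by rewrite h|by rewrite h1|].
rewrite !dactw_cat; congr (dactw _ _).
by case: e => [[s [t [st -> ->]]]|[s [-> ->]]]; [apply: dactw_braid|apply: dact_invol].
Qed.

Lemma wv_altw_order s t k : s != t -> wv m (altw s t k.*2) = 1%g -> (m s t %| k)%N.
Proof.
by move=> st /clsP h; apply: dactw_order => // f; rewrite (congr_dactw h).
Qed.
End DualRepresentation.

(** * The weak order *)

(* Products in the Coxeter group may use distinct but convertible instances; [cox_lia] unifies them
   before calling [lia]. *)
Ltac unify_mul G := repeat match goal with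
  | |- context [@monoid.mul ?H ?a ?b] =>
      tryif constr_eq H G then fail else change (@monoid.mul H a b) with (@monoid.mul G a b)
  | h : context [@monoid.mul ?H ?a ?b] |- _ =>
      tryif constr_eq H G then fail else change (@monoid.mul H a b) with (@monoid.mul G a b) in h
  end.

Ltac cox_lia m := lazymatch constr:((coxg m : magmaType)) with
  | (?H : _) => unify_mul H | ?H => unify_mul H end; lia.

Section WeakOrder.
Variables (S : finType) (m : S -> S -> nat).
Hypothesis mC : forall s t, m s t = m t s.
Hypothesis m2 : forall s t, s != t -> 2 <= m s t.
Local Notation W := (coxg m).
Local Notation wv := (wv m).
Local Notation g s := (wv [:: s]).
Implicit Types (a b c w x y z : W).

(** The reflections along the word are alternating words of lengths 1, 3, 5 and so on; two equal
    ones would make a power of a product of [s] and [t] trivial, with positive exponent below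
    [m s t]. *)
Lemma clen_altw s t n : s != t -> n <= m s t -> clen (wv (altw s t n)) = n.
Proof.
move=> st nm; rewrite reduced_uniq ?size_altw // refls_altw map_inj_in_uniq ?iota_uniq //.
move=> i j; rewrite !mem_iota !add0n /= => hi hj.
wlog ij : i j hi hj / i <= j.
  move=> h e; case: (leqP i j) => [/h|/ltnW/h]; first exact.
  by move=> /(_ hj hi (esym e)).
have -> : j.*2.+1 = i.*2.+1 + (j - i).*2 by rewrite doubleB; lia.
rewrite wv_altw_add /= odd_double /= -{1}[wv _]mulg1 => /mulgI/esym.
move/(wv_altw_order mC m2) => /(_ _)/dvdn_leq h.
apply/eqP; rewrite eqn_leq ij /=; apply: contraT; rewrite -ltnNge => lt.
have : m t s <= j - i by apply: h; rewrite 1?eq_sym // subn_gt0.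
by rewrite mC; lia.
Qed.

Definition wok s w := clen (g s * w) = (clen w).+1.
Definition ldiv a b : W := a^-1 * b.
Lemma mul_ldiv a b : a * ldiv a b = b. Proof. exact: mulVKg. Qed.
Lemma ldiv_mul a b : ldiv a (a * b) = b. Proof. exact: mulKg. Qed.
Lemma ldiv1 a : ldiv 1 a = a. Proof. by rewrite /ldiv invg1 mul1g. Qed.
Lemma ldivv a : ldiv a a = 1. Proof. exact: mulVg. Qed.
Lemma ldiv_trans a b c : ldiv a b * ldiv b c = ldiv a c.
Proof. by rewrite /ldiv -mulgA mulVKg. Qed.
Lemma ldivM a b c : ldiv (a * b) c = ldiv b (ldiv a c).
Proof. by rewrite /ldiv invgM -mulgA. Qed.
Lemma ldiv_gen s a : ldiv (g s) a = g s * a.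
Proof. by rewrite /ldiv wv_genV. Qed.
Lemma genK s a : g s * (g s * a) = a.
Proof. by rewrite mulgA wvss mul1g. Qed.

Definition wle a b := clen b = clen a + clen (ldiv a b).

Lemma wle_refl a : wle a a. Proof. by rewrite /wle ldivv clen1 addn0. Qed.
Lemma wle_one a : wle 1 a. Proof. by rewrite /wle ldiv1 clen1. Qed.
Lemma wle_trans a b c : wle a b -> wle b c -> wle a c.
Proof.
rewrite /wle => h1 h2.
have := clenM_le (ldiv a b) (ldiv b c); rewrite ldiv_trans => h3.
have := clenM_le a (ldiv a c); rewrite mul_ldiv => h4; cox_lia m.
Qed.
Lemma wle_anti a b : wle a b -> wle b a -> a = b.
Proof.
rewrite /wle => h1 h2; have : clen (ldiv a b) = 0%N by cox_lia m.
by move/clen_eq0 => h; rewrite -(mul_ldiv a b) h mulg1.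
Qed.
Lemma wle_mulr a b : clen (a * b) = clen a + clen b -> wle a (a * b).
Proof. by rewrite /wle ldiv_mul. Qed.

Lemma wle_mul s a b : wok s a -> wok s b -> wle (g s * a) (g s * b) <-> wle a b.
Proof. by rewrite /wok /wle ldivM ldiv_mul => -> ->; cox_lia m. Qed.

Lemma clen_gen_ge s w : clen w <= (clen (g s * w)).+1.
Proof. by have := clen_gen_le s (g s * w); rewrite genK. Qed.

Lemma wle_mulE s a b : wok s a -> wle (g s * a) b -> exists2 b', wok s b' & b = g s * b'.
Proof.
rewrite /wok /wle ldivM ldiv_gen => h1; rewrite h1 => h2.
exists (g s * b); rewrite genK //; have h3 := clen_gen_ge s b.
have := clenM_le a (ldiv a (g s * b)); rewrite mul_ldiv => h4; cox_lia m.
Qed.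

Lemma wle_ok s a b : wok s b -> wle a b -> wok s a.
Proof.
rewrite /wok /wle => h1 h2; have h3 := clen_gen_le s a.
have := clenM_le (g s * a) (ldiv a b); rewrite -mulgA mul_ldiv => h4; cox_lia m.
Qed.

Lemma wcase w : w = 1 \/ exists s b, wok s b /\ w = g s * b.
Proof.
have [[|s u] e ew] := reduced_ex w; first by left; rewrite -ew.
have ew' : w = g s * wv u by rewrite -wvM -ew.
right; exists s, (wv u); rewrite /wok -ew'; split=> //.
have h1 := clen_le m u; have := clen_gen_le s (wv u); rewrite -ew'.
by rewrite -e /= => h2; cox_lia m.
Qed.

Lemma wok_par s w : wok s w <-> ~~ Par w (g s).
Proof.
rewrite /wok clen_gen; case: ifP => // h; split=> //.
by have := Par_clen h; cox_lia m.
Qed.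

Lemma desc_par s w : (exists2 b, wok s b & w = g s * b) <-> Par w (g s).
Proof.
split=> [[b ok ->]|h].
  by rewrite ParM Par_gen eqxx conjgE mulKg; move/wok_par: ok => /negbTE ->.
exists (g s * w); last by rewrite mulgA wvss mul1g.
rewrite /wok mulgA wvss mul1g clen_gen h.
by have := Par_clen h; cox_lia m.
Qed.

(** Multiplying by the descent [t] deletes one letter of [w]. It is not in the alternating prefix,
    since [t] followed by that prefix is still reduced; so the prefix survives and gains [t] in
    front. *)
Lemma altw_prefix_step s t n w' w : s != t -> n < m s t ->
  w = wv (altw s t n) * w' -> clen w = n + clen w' -> Par w (g t) ->
  exists w'', w = wv (altw t s n.+1) * w'' /\ clen w = n.+1 + clen w''.
Proof.
move=> st nm ew lw pw; have [v lv ev] := reduced_ex w'.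
have ew' : w = wv (altw s t n ++ v) by rewrite wvM ev.
have eS : wv (altw t s n.+1) = g t * wv (altw s t n) by rewrite altwS -wvM.
have lt : clen (g t * wv (altw s t n)) = n.+1.
  by rewrite -eS; apply: clen_altw; rewrite 1?eq_sym // mC.
move: pw; rewrite ew' => /Par_del[i]; rewrite size_cat size_altw => hi e.
have [lin|lni] := ltnP i n.
  suff : clen (g t * wv (altw s t n)) <= n by rewrite lt ltnn.
  have -> : g t * wv (altw s t n) = wv (del i (altw s t n)).
    apply: (mulIg (wv v)); rewrite -mulgA -(wvM m (altw s t n) v) e -(wvM m (del i (altw s t n)) v); congr wv.
    rewrite /del take_cat drop_cat size_altw lin -catA; congr (_ ++ _).
    have [//|ge1] := ltnP i.+1 n; have -> : i.+1 = n by lia.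
    by rewrite subnn drop0 drop_oversize ?size_altw.
  apply: (leq_trans (clen_le m _)).
  by have := @size_del _ i (altw s t n); rewrite size_altw => /(_ lin); lia.
have h1 : i - n < size v by cox_lia m.
have h2 := size_del h1; have h3 := clen_le m (del (i - n) v).
have e2 : wv (altw s t n ++ v) = wv (altw t s n.+1) * wv (del (i - n) v).
  rewrite eS -mulgA; apply: (mulgI (g t)).
  rewrite e genK -(wvM m (altw s t n)); congr wv.
  rewrite /del take_cat drop_cat size_altw ltnNge lni /= ltnNge leqW //= -catA.
  by rewrite subSn.
exists (wv (del (i - n) v)); split; first by rewrite e2.
have h4 := clenM_le (wv (altw t s n.+1)) (wv (del (i - n) v)).
have h5 := clen_le m (altw t s n.+1); rewrite size_altw in h5.
by rewrite -e2 -ew' in h4; rewrite -ew'; cox_lia m.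
Qed.

Lemma altw_prefix s t w : s != t -> Par w (g s) -> Par w (g t) ->
  wle (wv (altw s t (m s t))) w.
Proof.
move=> st ps pt.
have P n : n <= m s t -> (exists w', w = wv (altw s t n) * w' /\ clen w = n + clen w') /\
   (exists w', w = wv (altw t s n) * w' /\ clen w = n + clen w').
  elim: n => [|n IH] nm.
    by split; exists w; rewrite mul1g.
  have [[w1 [e1 l1]] [w2 [e2 l2]]] := IH (ltnW nm); split.
    by apply: altw_prefix_step e2 l2 ps; rewrite 1?eq_sym // mC.
  exact: altw_prefix_step e1 l1 pt.
have [[w' [e l]] _] := P _ (leqnn _).
by rewrite /wle l e ldiv_mul clen_altw.
Qed.

Lemma wle_lcm a b c : wle a c -> wle b c ->
  exists j, [/\ wle a j, wle b j & forall h, wle a h -> wle b h -> wle j h].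
Proof.
move=> ac bc.
suff [j [j1 j2 j3 _]] : exists j, [/\ wle a j, wle b j, forall h, wle a h -> wle b h -> wle j h &
    @set0 S \subset set0 :|: set0] by exists j.
apply: (@bounded_lcm S S W 1 (fun s a => g s * a) wok (@clen _ m) (fun _ => set0) (fun _ => set0)
  wle _ _ _ _ _ _ _ _ _ _ a b c) => //.
- exact: wle_refl.
- exact: wle_trans.
- exact: wle_one.
- exact: wle_mul.
- exact: wle_mulE.
- exact: wle_ok.
- exact: wcase.
- by move=> s x _; rewrite setU0.
move=> s t x y st okx oky e.
have dec s' t' : s' != t' -> wok s' (wv (altw t' s' (m s' t').-1)) /\
    g s' * wv (altw t' s' (m s' t').-1) = wv (altw s' t' (m s' t')).
  move=> st'; have m0 : 0 < m s' t' by have := m2 st'; cox_lia m.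
  have e' : g s' * wv (altw t' s' (m s' t').-1) = wv (altw s' t' (m s' t')).
    by rewrite -wvM -[_ ++ _]altwS prednK.
  split=> //; rewrite /wok e' !clen_altw //; first by rewrite prednK.
    by rewrite eq_sym.
  by rewrite (mC t') leq_pred.
exists (wv (altw t s (m s t).-1)), (wv (altw s t (m t s).-1)).
have [k1 k2] := dec s t st; have [|k3 k4] := dec t s; first by rewrite eq_sym.
split.
  by split; rewrite ?sub0set // k2 k4 wv_braid // mC.
move=> h /desc_par h1 /desc_par h2; rewrite k2; exact: altw_prefix.
Qed.

(** * The longest element *)

(** The contributions of [x] and [x^-1] cancel, leaving that of the middle letter. *)
Lemma ParV_refl x s : Par (x * g s * x^-1) (g s ^ x^-1).
Proof.
set t := g s ^ x^-1.
have tx : t ^ x = g s by rewrite /t conjgKV.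
have e1 : Par x t (+) Par x^-1 (g s) = false.
  by rewrite -tx -ParM mulgV (Par_wv (m := m) [::]).
rewrite -mulgA !ParM tx Par_gen eqxx conjgE mulKg.
by move: e1; case: (Par x t); case: (Par x^-1 (g s)).
Qed.

Lemma refl_conj u t0 : t0 \in refls m u -> exists x s, t0 = g s ^ x^-1.
Proof.
case/(nthP 1) => i; rewrite size_refls => hi <-; case: u hi => // s0 u hi.
by rewrite (refls_nth m s0) //; exists (wv (take i (s0 :: u))), (nth s0 (s0 :: u) i).
Qed.

Section Longest.
Variable w0 : W.
Hypothesis w0max : forall w, clen w <= clen w0.

(** If [t] had even parity in [w0], it would have odd parity in [t * w0], and [w0 = t * (t * w0)]
    would be shorter than [t * w0]. *)
Lemma Par_longest x s : Par w0 (g s ^ x^-1).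
Proof.
set t := g s ^ x^-1.
have et : x * g s * x^-1 = t by rewrite /t conjgE invgK mulgA.
have pt : Par t t by have := ParV_refl x s; rewrite et.
apply: contraT => n; have : Par (t * w0) t.
  by rewrite ParM pt conjgE mulKg (negbTE n).
move/Par_clen; rewrite mulgA.
have -> : t * t = 1 by rewrite /t -conjMg wvss conj1g.
by rewrite mul1g ltnNge w0max.
Qed.

(** Concatenate reduced words of [x] and of its quotient in [w0]: a reflection met in both parts
    would have even parity, against [Par_longest]. *)
Lemma longest_compl x : wle x w0.
Proof.
have [u lu eu] := reduced_ex x; have [v lv ev] := reduced_ex (ldiv x w0).
have e : wv (u ++ v) = w0 by rewrite wvM eu ev mul_ldiv.
rewrite /wle -lu -lv -size_cat -e; apply: reduced_uniq => //.
have uu : uniq (refls m u) by apply: uniq_refls => //; rewrite eu.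
have uv : uniq (refls m v) by apply: uniq_refls => //; rewrite ev.
rewrite refls_cat cat_uniq uu map_inj_uniq ?uv ?andbT /=; last exact: conjg_inj.
apply/hasPn => t tv; apply/negP => tu.
have [y [s et]] := refl_conj tu.
have : Par w0 t by rewrite et Par_longest.
rewrite -e Par_wv /par refls_cat count_cat !count_uniq_mem ?tu ?tv //.
by rewrite map_inj_uniq //; apply: conjg_inj.
Qed.

Lemma longest_invol : w0 * w0 = 1.
Proof.
have := longest_compl w0^-1; rewrite /wle /ldiv clenV invgK => h.
by apply: clen_eq0; move/eqP: h; rewrite -{1}[clen w0]addn0 eqn_add2l => /eqP.
Qed.
End Longest.
End WeakOrder.

(** * The monoid of positive braids *)

Section BraidMonoid.
Variables (S : finType) (m : S -> S -> nat).
Hypothesis mC : forall s t, m s t = m t s.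
Hypothesis m2 : forall s t, s != t -> 2 <= m s t.
Local Notation W := (coxg m).
Local Notation wv := (wv m).
Local Notation g s := (wv [:: s]).
Local Notation A := (quot (braid m)).
Local Notation bc := (cls (braid m)).
Implicit Types (u v : seq S) (w x y z : W) (a b c : A).

Lemma mem_altw (s t : S) n : 2 <= n -> altw s t n =i [:: s; t].
Proof.
move=> n2 x; apply/mapP/idP => [[i _ ->]|]; rewrite !inE.
  by case: (odd i); rewrite eqxx ?orbT.
case/orP => /eqP ->; first by exists 0; rewrite ?mem_iota //; lia.
by exists 1%N; rewrite ?mem_iota //; lia.
Qed.

Lemma congr_braid u v : congr_gen (braid m) u v ->
  [/\ size u = size v, u =i v & congr_gen (cox m) u v].
Proof.
elim=> [w|w1 w2 _ [h1 h2 h3]|w1 w2 w3 _ [h1 h2 h3] _ [k1 k2 k3]|w a b w' e].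
- by split=> //; apply: congr_refl.
- by split=> //; apply: congr_sym.
- by split; [rewrite h1|move=> x; rewrite h2|apply: congr_trans k3].
split; last by apply: congr_step; left.
  by case: e => s [t [st -> ->]]; rewrite !size_cat !size_altw.
case: e => s [t [st -> ->]] x; rewrite !mem_cat !mem_altw ?m2 //.
by rewrite !inE (orbC (x == s)).
Qed.

Definition lenA a := size (qrep a).
Definition suppA a := [set s in qrep a].
Definition pi a : W := wv (qrep a).

Lemma lenA_bc u : lenA (bc u) = size u.
Proof. by have [-> _ _] := congr_braid (canon_congr (braid m) u). Qed.
Lemma suppA_bc u : suppA (bc u) = [set s in u].
Proof.
by apply/setP => x; rewrite !inE; have [_ -> _] := congr_braid (canon_congr (braid m) u).
Qed.
Lemma pi_bc u : pi (bc u) = wv u.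
Proof. by apply/clsP; have [_ _ /congr_sym] := congr_braid (canon_congr (braid m) u). Qed.

Lemma bcE a : exists u, a = bc u. Proof. by exists (qrep a); rewrite qrepK. Qed.
Lemma bcM u v : bc (u ++ v) = bc u * bc v. Proof. exact: clsM. Qed.
Lemma lenAM a b : lenA (a * b) = lenA a + lenA b.
Proof. by have [u ->] := bcE a; have [v ->] := bcE b; rewrite -bcM !lenA_bc size_cat. Qed.
Lemma suppAM a b : suppA (a * b) = suppA a :|: suppA b.
Proof.
have [u ->] := bcE a; have [v ->] := bcE b; rewrite -bcM !suppA_bc.
by apply/setP => x; rewrite !inE mem_cat.
Qed.
Lemma piM a b : pi (a * b) = pi a * pi b.
Proof. by have [u ->] := bcE a; have [v ->] := bcE b; rewrite -bcM !pi_bc wvM. Qed.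

Lemma bc_braid s t : s != t -> bc (altw s t (m s t)) = bc (altw t s (m t s)).
Proof.
move=> st; apply/clsP.
have := @congr_step _ (braid m) [::] (altw s t (m s t)) (altw t s (m s t)) [::].
by rewrite /= !cats0 (mC t); apply; exists s, t.
Qed.

(** * Lifting the Coxeter group to the monoid *)

Lemma reduced_cons s u : clen (wv (s :: u)) = size (s :: u) -> clen (wv u) = size u.
Proof.
move=> e; have := clen_le m u; have := clen_gen_le s (wv u).
by rewrite -wvM /= e /=; lia.
Qed.

Lemma reduced_desc s u : clen (wv (s :: u)) = size (s :: u) -> Par (wv (s :: u)) (g s).
Proof.
move=> e; apply/desc_par; exists (wv u); last by rewrite -wvM.
by rewrite /wok -wvM /= e (reduced_cons e).
Qed.

(** Matsumoto's theorem. If the first letters [s] and [t] differ, both are descents, so the element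
    also has reduced words beginning with either alternating word of length [m s t]. A braid
    relation joins these two, and each shares its first letter with one of the given words. *)
Lemma matsumoto u v : clen (wv u) = size u -> clen (wv v) = size v -> wv u = wv v -> bc u = bc v.
Proof.
elim: (size u).+1 {-2}u (ltnSn (size u)) v => {u} // n IH u lu v ru rv e.
have suv : size v = size u by rewrite -rv -e.
case: u lu ru e suv => [|s u] lu ru e suv; first by move/size0nil: suv => ->.
case: v rv e suv => [//|t v] rv e suv.
have cancel r u1 v1 : size u1 < n -> clen (wv (r :: u1)) = size (r :: u1) ->
    clen (wv (r :: v1)) = size (r :: v1) -> wv (r :: u1) = wv (r :: v1) ->
    bc (r :: u1) = bc (r :: v1).
  move=> l r1 r2 e'; rewrite (cls_cons _ r u1) (cls_cons _ r v1); congr (_ * _).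
  apply: IH => //; [exact: reduced_cons r1|exact: reduced_cons r2|].
  by apply: (mulgI (g r)); rewrite -!wvM.
have [est|st] := eqVneq s t.
  by subst t; apply: cancel.
have ds := reduced_desc ru; have dt := reduced_desc rv; rewrite -e in dt.
have le := altw_prefix mC m2 st ds dt.
have [z lz ez] := reduced_ex (ldiv (wv (altw s t (m s t))) (wv (s :: u))).
have mst := m2 st.
have eA : altw s t (m s t) = s :: altw t s (m s t).-1.
  by rewrite -altwS prednK //; lia.
have eB : altw t s (m t s) = t :: altw s t (m t s).-1.
  by rewrite -altwS prednK // mC; lia.
have ea : wv (altw s t (m s t) ++ z) = wv (s :: u) by rewrite wvM ez mul_ldiv.
have eb : wv (altw t s (m t s) ++ z) = wv (t :: v).
  by rewrite wvM (mC t s) -wv_braid // -wvM ea.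
have sA : size (altw s t (m s t) ++ z) = size (s :: u).
  by move: le; rewrite /wle ru -lz clen_altw // size_cat size_altw.
have sB : size (altw t s (m t s) ++ z) = size (t :: v).
  by rewrite suv -sA !size_cat !size_altw mC.
have -> : bc (s :: u) = bc (altw s t (m s t) ++ z).
  move: ea sA; rewrite eA /= => ea sA; apply: cancel => //; first by rewrite ea /= sA.
have -> : bc (t :: v) = bc (altw t s (m t s) ++ z).
  move: eb sB; rewrite eB /= => eb sB; apply: cancel => //; last by rewrite eb /= sB.
  by move: suv => /= [->].
by rewrite !bcM bc_braid.
Qed.

Definition lift w : A := bc (sval (cid2 (reduced_ex w))).
Lemma lift_wv u : clen (wv u) = size u -> lift (wv u) = bc u.
Proof.
rewrite /lift => h; case: cid2 => v /= lv ev; apply: matsumoto => //.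
by rewrite ev.
Qed.
Lemma liftM x y : clen (x * y) = clen x + clen y -> lift (x * y) = lift x * lift y.
Proof.
have [u lu eu] := reduced_ex x; have [v lv ev] := reduced_ex y.
rewrite -eu -ev => h; rewrite -wvM !lift_wv ?bcM ?eu ?ev //.
by rewrite wvM h size_cat lu lv eu ev.
Qed.
Lemma lift_ldiv x y : wle x y -> lift y = lift x * lift (ldiv x y).
Proof. by move=> xy; rewrite -liftM mul_ldiv. Qed.
Lemma lift1 : lift 1 = 1.
Proof. exact: (@lift_wv [::] (clen1 m)). Qed.
Lemma lift_gen s : lift (g s) = bc [:: s].
Proof.
apply: lift_wv; have := @clen_gen _ m s 1.
by rewrite mulg1 (Par_wv (m := m) [::]) clen1.
Qed.
Lemma pi_lift w : pi (lift w) = w.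
Proof. by rewrite /lift; case: cid2 => u /= _ eu; rewrite pi_bc. Qed.
Lemma len_lift w : lenA (lift w) = clen w.
Proof. by rewrite /lift; case: cid2 => u /= lu _; rewrite lenA_bc. Qed.

Variable w0 : W.
Hypothesis w0max : forall w, clen w <= clen w0.

Definition red x y := clen (x * y) = clen x + clen y.

(** Since every element is a prefix of [w0], the length-additive right factors of [x] form an
    interval of the weak order and are closed under joins. *)
Lemma redP x y : red x y <-> wle y (ldiv x w0).
Proof.
rewrite /red /wle -ldivM; have := longest_compl w0max x; have := longest_compl w0max (x * y).
by rewrite /wle => h1 h2; split=> h; cox_lia m.
Qed.

Lemma mx_ex x w : exists y, [/\ wle y w, red x y & forall z, wle z w -> red x z -> wle z y].
Proof.
pose p n := `[< exists y, [/\ wle y w, red x y & clen y = n] >].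
have ex : exists n, p n.
  exists 0; apply/asboolP; exists 1; split; [exact: wle_one| |exact: clen1].
  by rewrite /red mulg1 clen1 addn0.
have ub n : p n -> n <= clen w.
  by move=> /asboolP[y [h _ <-]]; rewrite /wle in h; lia.
case: (ex_maxnP ex ub) => n /asboolP[y [yw ry ly]] my.
exists y; split=> // z zw rz; have [j [yj zj mj]] := wle_lcm mC m2 yw zw.
have jw : wle j w by apply: mj.
have rj : red x j by apply/redP; apply: mj; apply/redP.
have /my : p (clen j) by apply/asboolP; exists j.
rewrite -ly => lj; suff -> : y = j by [].
have : clen (ldiv y j) = 0%N by move: yj; rewrite /wle; lia.
by move/clen_eq0 => h; rewrite -(mul_ldiv y j) h mulg1.
Qed.
Definition mx x w := sval (cid (mx_ex x w)).
Lemma mx_wle x w : wle (mx x w) w. Proof. by rewrite /mx; case: cid => y []. Qed.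
Lemma mx_red x w : red x (mx x w). Proof. by rewrite /mx; case: cid => y []. Qed.
Lemma mx_max x w z : wle z w -> red x z -> wle z (mx x w).
Proof. by rewrite /mx; case: cid => y [] /= _ _ m'; apply: m'. Qed.

(* Left multiplication on pairs (greatest simple prefix, remainder) *)
Definition act x (p : W * A) : W * A := (x * mx x p.1, lift (ldiv (mx x p.1) p.1) * p.2).

(** The point is that the factor extracted by [x] from [y * v] is [y * z]: it begins with [y], and
    the rest is a length-additive factor for [x * y] in [w]. *)
Lemma act_mul x y p : red x y -> act (x * y) p = act x (act y p).
Proof.
move=> rxy; case: p => w a; rewrite /act /=.
set z := mx (x * y) w; set v := mx y w.
have rz : red (x * y) z by apply: mx_red.
have zw : wle z w by apply: mx_wle.
have lv : red y v by apply: mx_red.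
have vw : wle v w by apply: mx_wle.
have rxy' := rxy; rewrite /red in rz lv rxy'.
have yz : red y z.
  rewrite /red; have := clenM_le y z; have := clenM_le x (y * z).
  by rewrite mulgA => h1 h2; cox_lia m.
have zv : wle z v by apply: mx_max.
have yzyv : wle (y * z) (y * v).
  by move: zv yz; rewrite /wle /red ldivM ldiv_mul => h1 h2; cox_lia m.
have rx : red x (y * z).
  by move: yz; rewrite /red mulgA => h1; cox_lia m.
have -> : mx x (y * v) = y * z.
  apply: wle_anti; last exact: mx_max.
  have yq : wle y (mx x (y * v)) by apply: mx_max => //; apply: wle_mulr.
  set q := mx x (y * v) in yq *.
  have qv : wle q (y * v) by apply: mx_wle.
  have rq : red x q by apply: mx_red.
  have eq : y * ldiv y q = q by rewrite mul_ldiv.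
  have lq : clen q = clen y + clen (ldiv y q) by [].
  have h1 : wle (ldiv y q) v.
    move: qv; rewrite /wle; have -> : ldiv (ldiv y q) v = ldiv q (y * v).
      by rewrite -[in RHS]eq ldivM ldiv_mul.
    by move=> h; cox_lia m.
  have h2 : red (x * y) (ldiv y q).
    by move: rq; rewrite /red -mulgA eq => h; cox_lia m.
  have h3 : wle (ldiv y q) z by apply: mx_max h2; apply: wle_trans vw.
  rewrite -eq; move: h3; rewrite /wle ldivM ldiv_mul eq => h3.
  by move: yz; rewrite /red => h; cox_lia m.
rewrite mulgA ldivM ldiv_mul; congr (_, _).
have -> : ldiv z w = ldiv z v * ldiv v w by rewrite ldiv_trans.
rewrite liftM; first (by rewrite mulgA); rewrite ldiv_trans.
by move: zw zv vw; rewrite /wle; lia.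
Qed.

Lemma act1 p : act 1 p = p.
Proof.
case: p => w a; rewrite /act /=; have -> : mx 1 w = w.
  apply: wle_anti; first exact: mx_wle.
  by apply: mx_max; [apply: wle_refl|rewrite /red mul1g clen1].
by rewrite mul1g ldivv lift1 mul1g.
Qed.

Definition actw u p := foldr (fun s => act (g s)) p u.

Lemma actw_reduced u p : clen (wv u) = size u -> actw u p = act (wv u) p.
Proof.
elim: u => [|s u IH] h; first by rewrite act1.
rewrite /= IH; last exact: reduced_cons h.
have e : wv (s :: u) = g s * wv u by rewrite -wvM.
rewrite e act_mul // /red -e h /= (reduced_cons h).
have h1 := clen_le m [:: s]; have := clenM_le (g s) (wv u); rewrite -e h (reduced_cons h) /= in h1 *.
by lia.
Qed.

Lemma congr_actw u v : congr_gen (braid m) u v -> forall p, actw u p = actw v p.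
Proof.
elim=> [//|w1 w2 _ h p|w1 w2 w3 _ h1 _ h2 p|w a b w' e p]; [by rewrite h|by rewrite h1|].
rewrite /actw !foldr_cat -!/(actw _ _); congr (actw _ _).
case: e => s [t [st -> ->]]; rewrite (@actw_reduced (altw s t _)) ?(@actw_reduced (altw t s _)).
- by rewrite wv_braid.
- by rewrite size_altw mC clen_altw // eq_sym.
by rewrite size_altw clen_altw.
Qed.

(** A word for [a] acts on the trivial pair; the action respects braid relations because both sides
    are reduced words of one element. *)
Definition nf a := actw (qrep a) (1, 1).
Lemma nf_cons s a : nf (bc [:: s] * a) = act (g s) (nf a).
Proof.
have [u ->] := bcE a; rewrite -bcM /nf.
by rewrite (congr_actw (congr_sym (canon_congr _ _))) /= (congr_actw (congr_sym (canon_congr _ u))).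
Qed.

Lemma nf_prod a : a = lift (nf a).1 * (nf a).2.
Proof.
have [u ->] := bcE a; elim: u => [|s u IH].
  by rewrite /nf (congr_actw (congr_sym (canon_congr _ _))) /= lift1 mul1g.
rewrite cls_cons nf_cons /act /= {1}IH.
rewrite liftM ?lift_gen; last exact: mx_red.
by rewrite -!mulgA; congr (_ * _); rewrite mulgA -lift_ldiv //; apply: mx_wle.
Qed.

(** The pair of [s * a] determines the prefix [mx (g s) (nf a).1] and what follows it in [a]; their
    product is [a]. *)
Lemma genA_canl s a b : bc [:: s] * a = bc [:: s] * b -> a = b.
Proof.
move=> e; have := nf_cons s a; rewrite e nf_cons => h.
have /mulgI e1 := congr1 fst h; have e2 := congr1 snd h; rewrite /= in e1 e2.
rewrite (nf_prod a) (nf_prod b) (lift_ldiv (mx_wle (g s) (nf a).1)).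
by rewrite (lift_ldiv (mx_wle (g s) (nf b).1)) -!mulgA -e2 e1.
Qed.

Lemma nf_desc s a : Par (nf (bc [:: s] * a)).1 (g s).
Proof.
rewrite nf_cons /act /=; apply/desc_par; exists (mx (g s) (nf a).1) => //.
have := mx_red (g s) (nf a).1; rewrite /red /wok => ->.
by rewrite -(len_lift (g s)) lift_gen lenA_bc add1n.
Qed.

Lemma lcmA s t a b : s != t -> bc [:: s] * a = bc [:: t] * b ->
  exists2 e, a = bc (altw t s (m s t).-1) * e & b = bc (altw s t (m t s).-1) * e.
Proof.
move=> st e; have ds := nf_desc s a; have dt := nf_desc t b; rewrite -e in dt.
have le := altw_prefix mC m2 st ds dt.
set c := bc [:: s] * a in e ds dt le.
have mst := m2 st; have [r ec] : exists r, c = bc (altw s t (m s t)) * r.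
  exists (lift (ldiv (wv (altw s t (m s t))) (nf c).1) * (nf c).2).
  rewrite {1}(nf_prod c) (lift_ldiv le).
  by rewrite lift_wv ?mulgA // clen_altw ?size_altw.
have eA : altw s t (m s t) = s :: altw t s (m s t).-1.
  by rewrite -altwS prednK //; lia.
have eB : altw t s (m t s) = t :: altw s t (m t s).-1.
  by rewrite -altwS prednK // mC; lia.
exists r.
  apply: (@genA_canl s); rewrite -/c ec [in LHS]eA.
  by rewrite (cls_cons (braid m) s (altw t s (m s t).-1)) -mulgA.
apply: (@genA_canl t); rewrite -e ec bc_braid // [in LHS]eB.
by rewrite (cls_cons (braid m) t (altw s t (m t s).-1)) -mulgA.
Qed.
End BraidMonoid.

(** * The Garside structure of the monoid of positive braids *)

Section BraidGarside.
Variables (S : finType) (m : S -> S -> nat).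
Hypothesis mC : forall s t, m s t = m t s.
Hypothesis m2 : forall s t, s != t -> 2 <= m s t.
Local Notation W := (coxg m).
Local Notation wv := (wv m).
Local Notation g s := (wv [:: s]).
Local Notation A := (quot (braid m)).
Local Notation bc := (cls (braid m)).
Local Notation gen s := (bc [:: s]).
Local Notation lift := (@lift S m).
Implicit Types (u v : seq S) (w x y z : W) (a b c : A).

(** An anti-automorphism of the monoid, by which facts on left divisors give those on right
    divisors. *)
Definition revA a : A := bc (rev (qrep a)).

Lemma congr_rev u v : congr_gen (braid m) u v -> congr_gen (braid m) (rev u) (rev v).
Proof.
elim=> [w|w1 w2 _ h|w1 w2 w3 _ h1 _ h2|w a b w' e].
- exact: congr_refl.
- exact: congr_sym.
- exact: congr_trans h2.
rewrite !rev_cat -!catA; case: e => s [t [st -> ->]]; rewrite !rev_altw.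
by case: ifP => _; [|apply: congr_sym]; apply: congr_step; exists s, t.
Qed.

Lemma revA_bc u : revA (bc u) = bc (rev u).
Proof. by apply/clsP/congr_rev/congr_sym; apply: canon_congr. Qed.
Lemma revAM a b : revA (a * b) = revA b * revA a.
Proof.
by have [u ->] := bcE a; have [v ->] := bcE b; rewrite -bcM !revA_bc rev_cat bcM.
Qed.
Lemma revAK : involutive revA.
Proof. by move=> a; have [u ->] := bcE a; rewrite !revA_bc revK. Qed.
Lemma revA_gen s : revA (gen s) = gen s. Proof. by rewrite revA_bc. Qed.
Lemma lenA_rev a : lenA (revA a) = lenA a.
Proof. by have [u ->] := bcE a; rewrite revA_bc !(lenA_bc m2) size_rev. Qed.
Lemma suppA_rev a : suppA (revA a) = suppA a.
Proof.
have [u ->] := bcE a; rewrite revA_bc !(suppA_bc m2).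
by apply/setP => s; rewrite !inE mem_rev.
Qed.
Lemma pi_rev a : pi (revA a) = (pi a)^-1.
Proof.
have [u ->] := bcE a; rewrite revA_bc !(pi_bc m2).
by rewrite wvV.
Qed.

Lemma lenA_gen s : lenA (gen s) = 1%N. Proof. exact: lenA_bc. Qed.
Lemma suppA_gen s : suppA (gen s) = [set s].
Proof. by rewrite (suppA_bc m2); apply/setP => t; rewrite !inE. Qed.
Lemma suppA1 : suppA (1 : A) = set0.
Proof. by rewrite (suppA_bc m2 [::]); apply/setP => t; rewrite !inE. Qed.
Lemma atomlA a : a = 1 \/ exists s b, a = gen s * b.
Proof.
have [[|s u] ->] := bcE a; first by left.
by right; exists s, (bc u); apply: cls_cons.
Qed.
Lemma atomrA a : a = 1 \/ exists s b, a = b * gen s.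
Proof.
have [[|s u] e] := bcE (revA a); [left|right]; rewrite -(revAK a) e revA_bc //.
by exists s, (bc (rev u)); rewrite rev_cons -cats1 bcM.
Qed.

Variable w0 : W.
Hypothesis w0max : forall w, clen w <= clen w0.

Lemma genA_canr s a b : a * gen s = b * gen s -> a = b.
Proof.
move=> /(congr1 revA); rewrite !revAM revA_gen => /(genA_canl mC m2 w0max) e.
by rewrite -(revAK a) e revAK.
Qed.

Lemma suppA_alt s t n : suppA (bc (altw s t n)) \subset [set s; t].
Proof.
rewrite (suppA_bc m2); apply/subsetP => x; rewrite !inE => /mapP[i _ ->].
by case: (odd i); rewrite eqxx ?orbT.
Qed.

Lemma lcmlA s t : s != t -> exists u v : A,
  [/\ gen s * u = gen t * v, suppA (gen s * u) \subset [set s; t],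
      forall a b, gen s * a = gen t * b -> exists2 e, a = u * e & b = v * e,
      adj m s t -> s \in suppA u & ~~ adj m s t -> u = gen t /\ v = gen s].
Proof.
move=> st; have mst := m2 st; exists (bc (altw t s (m s t).-1)), (bc (altw s t (m t s).-1)).
have e1 : gen s * bc (altw t s (m s t).-1) = bc (altw s t (m s t)).
  by rewrite -(cls_cons (braid m)) -altwS prednK //; lia.
have e2 : gen t * bc (altw s t (m t s).-1) = bc (altw t s (m t s)).
  by rewrite -(cls_cons (braid m)) -altwS prednK // mC; lia.
split.
- by rewrite e1 e2 bc_braid.
- by rewrite e1 suppA_alt.
- by move=> a b; apply: (lcmA mC m2 w0max).
- case/andP => _ m3; rewrite (suppA_bc m2) inE mem_altw ?inE ?eqxx ?orbT //; lia.
rewrite /adj st /= -leqNgt (mC t) => m3.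
by have -> : m s t = 2 by lia.
Qed.

Lemma lcmrA s t : s != t -> exists u v : A,
  [/\ u * gen s = v * gen t, suppA (u * gen s) \subset [set s; t] &
      forall a b, a * gen s = b * gen t -> exists2 e, a = e * u & b = e * v].
Proof.
move=> st; have [u [v [h1 h2 h3 _ _]]] := lcmlA st; exists (revA u), (revA v); split.
- by rewrite -(revA_gen s) -(revA_gen t) -!revAM h1.
- by rewrite -(revA_gen s) -revAM suppA_rev.
move=> a b /(congr1 revA); rewrite !revAM !revA_gen => /h3[e e1 e2].
by exists (revA e); rewrite -revAM -?e1 -?e2 revAK.
Qed.

Definition simpleA a := clen (pi a) = lenA a.
Definition DeltaA : A := lift w0.

Lemma clen_pi a : clen (pi a) <= lenA a. Proof. exact: clen_le. Qed.

Lemma simple_lift w : simpleA (lift w).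
Proof. by rewrite /simpleA (pi_lift m2) (len_lift m2). Qed.
Lemma lift_pi a : simpleA a -> lift (pi a) = a.
Proof. by move=> h; rewrite (lift_wv mC m2 h) qrepK. Qed.

Lemma simpleA_fac a b : simpleA (a * b) -> simpleA a /\ simpleA b.
Proof.
rewrite /simpleA (piM m2) (lenAM m2) => h; have := clenM_le (pi a) (pi b).
by have := clen_pi a; have := clen_pi b; lia.
Qed.

Lemma simpleAP a : simpleA a <-> dvl a DeltaA.
Proof.
split=> [h|[c e]].
  exists (lift (ldiv (pi a) w0)); rewrite -{1}(lift_pi h).
  by apply: (lift_ldiv mC m2); apply: longest_compl.
by have [] := @simpleA_fac a c; rewrite // -e; apply: simple_lift.
Qed.

Lemma pi_gen s : pi (gen s) = g s. Proof. exact: pi_bc. Qed.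

Lemma simpleA_sq s a : ~ simpleA (gen s * (gen s * a)).
Proof.
rewrite /simpleA !(piM m2) !(lenAM m2) lenA_gen pi_gen mulgA wvss mul1g.
by have := clen_pi a; lia.
Qed.

Lemma clen_gen1 s : clen (g s) = 1%N.
Proof. by rewrite -(len_lift m2) (lift_gen mC m2) lenA_gen. Qed.

Lemma simple_desc s a : simpleA a -> Par (pi a) (g s) -> dvl (gen s) a.
Proof.
move=> h /desc_par[b ok e]; exists (lift b); rewrite -(lift_pi h) -(lift_gen mC m2) e.
by apply: (liftM mC m2); rewrite ok clen_gen1.
Qed.

Lemma simpleA_l s a : simpleA a -> dvl (gen s) a \/ simpleA (gen s * a).
Proof.
move=> h; case ps : (Par (pi a) (g s)).
  by left; apply: simple_desc.
by right; rewrite /simpleA (piM m2) (lenAM m2) pi_gen clen_gen ps h lenA_gen.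
Qed.

Lemma simpleA_rev a : simpleA (revA a) <-> simpleA a.
Proof. by rewrite /simpleA pi_rev clenV lenA_rev. Qed.

Lemma simpleA_r s a : simpleA a -> dvr (gen s) a \/ simpleA (a * gen s).
Proof.
move=> /simpleA_rev/(simpleA_l s)[[c e]|h]; [left|right].
  by exists (revA c); rewrite -(revAK a) e revAM revA_gen.
by apply/simpleA_rev; rewrite revAM revA_gen.
Qed.

(** By the cocycle rule, [t] becomes a descent on appending [t'] only if conjugation by [w] takes
    [t] to [t']. So [t w = w t'] in the Coxeter group, where simple elements are determined by their
    images. *)
Lemma deodharA t t' (w w1 : A) : simpleA (w * gen t') -> w * gen t' = gen t * w1 ->
  ~ dvl (gen t) w -> w1 = w.
Proof.
move=> h e nd; have [hw _] := simpleA_fac h.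
have h1 := h; rewrite e in h1; have [_ hw1] := simpleA_fac h1.
have ew : pi w * g t' = g t * pi w1 by rewrite -!pi_gen -!(piM m2) e.
have np : Par (pi w) (g t) = false.
  by apply/negP => /(simple_desc hw).
have : Par (pi w * g t') (g t).
  rewrite ew; apply/desc_par; exists (pi w1) => //.
  by rewrite /wok -pi_gen -(piM m2) h1 hw1 (lenAM m2) lenA_gen.
rewrite ParM np Par_gen /= => /eqP et.
have ew2 : pi w1 = pi w by apply: (mulgI (g t)); rewrite -ew -et conjgC.
by rewrite -(lift_pi hw1) ew2 lift_pi.
Qed.

Lemma clen_compl x : clen (x^-1 * w0) = clen w0 - clen x.
Proof. by have := longest_compl w0max x; rewrite /wle /ldiv => ->; rewrite addKn. Qed.

Lemma gen_longest s : exists t, g s * w0 = w0 * g t.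
Proof.
have w0V : w0^-1 = w0 by apply: (mulgI w0); rewrite mulgV (longest_invol w0max).
have l1 : clen (w0 * g s * w0) = 1%N.
  have := clen_compl (g s * w0).
  rewrite invgM wv_genV w0V.
  have := clen_compl (g s); rewrite wv_genV => ->.
  rewrite clen_gen1 => ->; have := w0max (g s); rewrite clen_gen1; lia.
have [u] := reduced_ex (w0 * g s * w0); rewrite l1; case: u => [|t [|//]] // _ et.
by exists t; rewrite et !mulgA (longest_invol w0max) mul1g.
Qed.

Lemma Delta_commA s : exists t, gen s * DeltaA = DeltaA * gen t.
Proof.
have [t e] := gen_longest s; exists t.
have ls := clen_compl (g s); rewrite wv_genV clen_gen1 in ls.
have l0 := w0max (g s); rewrite clen_gen1 in l0.
have e1 : DeltaA = gen s * lift (g s * w0).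
  rewrite -(lift_gen mC m2) -(liftM mC m2) mulgA wvss mul1g //.
  by rewrite clen_gen1 ls; lia.
have e2 : DeltaA = lift (g s * w0) * gen t.
  rewrite -(lift_gen mC m2) -(liftM mC m2) e -mulgA wvss mulg1 //.
  by rewrite clen_gen1 -e ls; lia.
by rewrite [in LHS]e2 [in RHS]e1 mulgA.
Qed.

Definition ZA := DeltaA * DeltaA.

Lemma ZA_gen s : exists b, gen s * b = ZA.
Proof.
have [b e] : dvl (gen s) DeltaA.
  by apply/simpleAP; rewrite /simpleA pi_gen clen_gen1 lenA_gen.
by exists (b * DeltaA); rewrite mulgA -e.
Qed.

Lemma ZA_central a : a * ZA = ZA * a.
Proof.
have [u ->] := bcE a; elim: u => [|s u IH]; first by rewrite mul1g mulg1.
rewrite cls_cons -mulgA IH mulgA /ZA !mulgA; congr (_ * _).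
have [t e] := Delta_commA s; have [r e'] := Delta_commA t.
have l0 : pi DeltaA = w0 by rewrite /DeltaA (pi_lift m2).
have ers : gen r = gen s.
  rewrite -!(lift_gen mC m2) -!pi_gen; congr (lift _).
  have := congr1 (@pi _ _) e; have := congr1 (@pi _ _) e'.
  rewrite !(piM m2) l0 => h1 h2.
  have := mulgA (pi (gen s)) w0 w0; rewrite (longest_invol w0max) mulg1 h2 -mulgA h1.
  by rewrite mulgA (longest_invol w0max) mul1g.
by rewrite e -mulgA e' mulgA ers.
Qed.

End BraidGarside.

(** * The Garside results for positive braids *)

Section BraidCosets.
Variables (S : finType) (m : S -> S -> nat).
Hypothesis mC : forall s t, m s t = m t s.
Hypothesis m2 : forall s t, s != t -> 2 <= m s t.
Variable w0 : coxg m.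
Hypothesis w0max : forall w : coxg m, clen w <= clen w0.
Local Notation A := (quot (braid m)).
Local Notation bc := (cls (braid m)).
Local Notation gen s := (bc [:: s]).
Local Notation Z := (ZA w0).
Implicit Types (T : {set S}) (a b c : A).

(** The right-hand side of [ceqP], free of the hypotheses that [ceq] carries as arguments outside
    its section. *)
Definition cosetA T a b := exists x y : A, [/\ suppA x \subset T, suppA y \subset T & a * x = b * y].

Lemma adjC : symmetric (adj m).
Proof. by move=> s t; rewrite /adj eq_sym mC. Qed.

Lemma cosetAE T a b :
  ceq (lenAM m2) (lenA_gen m2) (suppAM m2) (suppA_gen m2) (suppA1 m2) (@atomlA _ m) T a b <->
  cosetA T a b.
Proof.
exact: (ceqP (@genA_canl _ _ mC m2 _ w0max) (genA_canr mC m2 w0max) (lenAM m2) (lenA_gen m2)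
  (suppAM m2) (suppA_gen m2) (suppA1 m2) (@atomlA _ m) (@atomrA _ m) (lcmlA mC m2 w0max) (lcmrA mC m2 w0max)
  (ZA_central mC m2 w0max) (ZA_gen mC m2 w0max)).
Qed.

Lemma cosetA_trans T a b c : cosetA T a b -> cosetA T b c -> cosetA T a c.
Proof. by move=> /cosetAE h1 /cosetAE h2; apply/cosetAE; apply: ceq_trans h2. Qed.
Lemma canrA a b c : b * a = c * a -> b = c.
Proof.
exact: (canr (genA_canr mC m2 w0max) (lenAM m2) (lenA_gen m2) (@atomlA _ m) (@atomrA _ m)).
Qed.

Lemma separatingA (a b c d : S) (a1 a2 g11 g12 g21 g22 : A) :
  cosetA [set~ a] g11 a1 -> cosetA [set~ a] g12 a1 ->
  cosetA [set~ b] g21 a2 -> cosetA [set~ b] g22 a2 ->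
  cosetA [set~ c] g11 g21 -> cosetA [set~ d] g12 g22 ->
  (exists (e : A) (N : nat), cosetA [set~ c] e (g11 * Z ^+ N) /\ cosetA [set~ d] e (g12 * Z ^+ N)) \/
  exists (n : A) (C : {set S}), [/\ c \in C, d \in C, a \notin C, b \notin C &
    forall k, k \notin C -> (exists2 r, r \in C & adj m k r) ->
     [/\ cosetA [set~ c] n g11,
         exists (e : A) (N : nat), cosetA [set~ k] e (n * Z ^+ N) /\ cosetA [set~ d] e (g12 * Z ^+ N),
         exists2 e, cosetA [set~ k] e n & cosetA [set~ a] e a1,
         exists2 e, cosetA [set~ k] e n & cosetA [set~ b] e a2 &
         (k = a -> cosetA [set~ k] n a1) /\ (k = b -> cosetA [set~ k] n a2)]].
Proof.
move=> /cosetAE h1 /cosetAE h2 /cosetAE h3 /cosetAE h4 /cosetAE h5 /cosetAE h6.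
have := separating_letters adjC (@genA_canl _ _ mC m2 _ w0max) (genA_canr mC m2 w0max)
  (@atomrA _ m) (lcmlA mC m2 w0max) (lcmrA mC m2 w0max)
  (ZA_central mC m2 w0max) (ZA_gen mC m2 w0max) (simpleAP mC m2 w0max) (@simpleA_fac _ _ m2)
  (simpleA_sq m2) (@simpleA_l _ _ mC m2) (@simpleA_r _ _ mC m2) (@deodharA _ _ mC m2)
  (Delta_commA mC m2 w0max) h1 h2 h3 h4 h5 h6.
case=> [[e [N [/cosetAE k1 /cosetAE k2]]]|[n [C [c1 c2 c3 c4 k]]]]; [left|right].
  by exists e, N.
exists n, C; split=> // r rC rr.
have [/cosetAE q1 [e [N [/cosetAE q2 /cosetAE q3]]] [e1 /cosetAE r1 /cosetAE r2]
  [e2 /cosetAE r3 /cosetAE r4] [q5 q6]] := k r rC rr.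
by split; [ |exists e, N|exists e1|exists e2|split=> e'; apply/cosetAE; [apply: q5|apply: q6]].
Qed.
End BraidCosets.

(** * The Artin group *)

Section ArtinGroup.
Variables (S : finType) (m : S -> S -> nat).
Local Notation word := (word S).
Implicit Types (u v w g h : word) (s t : S).

(** Free reduction is put among the relations, so that the group is the quotient of signed words by
    a plain congruence. *)
Definition artin_red (a b : word) := artin_rel m a b \/ exists x, a = [:: x; inv_letter x] /\ b = [::].
Definition artg : Type := quot artin_red.
HB.instance Definition _ := Monoid.on artg.
Definition av w : artg := cls artin_red w.

Lemma avM u v : av (u ++ v) = av u * av v. Proof. exact: clsM. Qed.
Lemma av0 : av [::] = 1. Proof. by []. Qed.
Lemma av_cons x u : av (x :: u) = av [:: x] * av u. Proof. exact: cls_cons. Qed.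

Lemma avP u v : artin_eq m u v <-> av u = av v.
Proof.
split=> [h|/clsP h].
  apply/clsP; elim: h => [w|w1 w2 _|w1 w2 w3 _ h1 _ h2|a b x|a b c d e].
  - exact: congr_refl.
  - exact: congr_sym.
  - exact: congr_trans h2.
  - apply: (congr_step a b (a := [:: x; inv_letter x]) (b := [::])).
    by right; exists x.
  - by apply: congr_step; left.
elim: h => [w|w1 w2 _|w1 w2 w3 _ h1 _ h2|a b c d [e|[x [-> ->]]]].
- exact: grp_eq_refl.
- exact: grp_eq_sym.
- exact: grp_eq_trans h2.
- exact: grp_eq_rel.
exact: grp_eq_free.
Qed.

Definition invw w : word := rev (map (@inv_letter S) w).

Lemma inv_letterK : involutive (@inv_letter S).
Proof. by case=> s b; rewrite /inv_letter /= negbK. Qed.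
Lemma invwK : involutive invw.
Proof. by move=> w; rewrite /invw map_rev revK (mapK inv_letterK). Qed.

Lemma av_letter x : av [:: x] * av [:: inv_letter x] = 1.
Proof. by rewrite -avM; apply/avP; apply: (grp_eq_free _ [::] [::]). Qed.

Lemma av_invw w : av w * av (invw w) = 1.
Proof.
elim: w => [|x w IH]; first by rewrite mul1g.
rewrite /invw /= rev_cons -cats1 avM (av_cons x w) -mulgA (mulgA (av w)).
by rewrite -/(invw w) IH mul1g av_letter.
Qed.

Definition ainv (x : artg) : artg := av (invw (qrep x)).
Lemma amulgV : right_inverse 1 ainv *%g.
Proof. by move=> w; rewrite -[X in X * _](qrepK w); apply: av_invw. Qed.
Lemma amulVg : left_inverse 1 ainv *%g.
Proof.
move=> w; rewrite -[X in _ * X](qrepK w) /ainv; have := av_invw (invw (qrep w)).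
by rewrite invwK.
Qed.
HB.instance Definition _ := hasInv.Build artg ainv.
HB.instance Definition _ := Monoid_isGroup.Build artg amulVg amulgV.

Lemma av_inv w : av (invw w) = (av w)^-1.
Proof. by apply: (mulgI (av w)); rewrite mulgV av_invw. Qed.

Lemma in_cosetP h U g : in_coset m h U g <->
  exists2 u : word, all (fun x => U x.1) u & av h * av u = av g.
Proof.
split=> [[u [h1 /avP h2]]|[u h1 h2]]; exists u; rewrite -?avM //.
by split=> //; apply/avP; rewrite avM.
Qed.

Lemma in_coset_refl h U : in_coset m h U h.
Proof. by apply/in_cosetP; exists [::] => //; rewrite av0 mulg1. Qed.
Lemma in_coset_sym h U g : in_coset m h U g -> in_coset m g U h.
Proof.
case/in_cosetP => u hu e; apply/in_cosetP; exists (invw u).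
  by rewrite /invw all_rev all_map; apply: sub_all hu.
by rewrite av_inv -e mulgK.
Qed.
Lemma in_coset_trans h U g k : in_coset m h U g -> in_coset m g U k -> in_coset m h U k.
Proof.
case/in_cosetP => u hu e /in_cosetP[v hv e']; apply/in_cosetP; exists (u ++ v).
  by rewrite all_cat hu hv.
by rewrite avM mulgA e.
Qed.

Lemma veqI x y : x.2 = y.2 -> in_coset m x.1 (hat x.2) y.1 -> veq m x y.
Proof.
move=> e h; split=> // g; rewrite -e; split=> h'.
  by apply: in_coset_trans h'; apply: in_coset_sym.
exact: in_coset_trans h'.
Qed.

Definition wp (u : seq S) : word := [seq (s, false) | s <- u].
Definition phi (a : quot (braid m)) : artg := av (wp (qrep a)).

Lemma wp_alt s t n : wp (altw s t n) = alt s t n.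
Proof. by rewrite /wp /altw /alt /mkseq -map_comp; apply: eq_map => i. Qed.

Lemma av_wp (u v : seq S) : congr_gen (braid m) u v -> av (wp u) = av (wp v).
Proof.
elim=> [//|w1 w2 _ -> //|w1 w2 w3 _ -> _ -> //|w a b w' [s [t [st -> ->]]]].
rewrite /wp !map_cat -!/(wp _) !wp_alt; apply/avP; apply: grp_eq_rel.
by exists s, t.
Qed.

Lemma phi_bc (u : seq S) : phi (cls (braid m) u) = av (wp u).
Proof. by apply: av_wp; apply: congr_sym; apply: canon_congr. Qed.
Lemma phiM a b : phi (a * b) = phi a * phi b.
Proof.
have [u ->] := bcE a; have [v ->] := bcE b.
by rewrite -bcM !phi_bc /wp map_cat avM.
Qed.
Lemma phi1 : phi 1 = 1. Proof. exact: (phi_bc [::]). Qed.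
Lemma phiX a n : phi (a ^+ n) = phi a ^+ n.
Proof. by elim: n => [|n IH]; rewrite ?phi1 // !expgS phiM IH. Qed.
End ArtinGroup.

(** * Elements of the Artin group as fractions with denominator a power of Z *)

Section Transfer.
Variables (S : finType) (m : S -> S -> nat).
Hypothesis mC : forall s t, m s t = m t s.
Hypothesis m2 : forall s t, s != t -> 2 <= m s t.
Variable w0 : coxg m.
Hypothesis w0max : forall w : coxg m, clen w <= clen w0.
Local Notation A := (quot (braid m)).
Local Notation bc := (cls (braid m)).
Local Notation gen s := (bc [:: s]).
Local Notation Z := (ZA w0).
Local Notation av := (av m).
Local Notation phi := (@phi S m).
Local Notation wA a := (wp (qrep a)).
Implicit Types (T : {set S}) (a b c : A) (w g h : word S) (s t : S).

Definition compl s : A := sval (cid (ZA_gen mC m2 w0max s)).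
Lemma gen_compl s : gen s * compl s = Z. Proof. by rewrite /compl; case: cid. Qed.
Lemma compl_gen s : compl s * gen s = Z.
Proof.
apply: (genA_canl mC m2 w0max (s := s)).
by rewrite mulgA gen_compl (ZA_central mC m2 w0max).
Qed.

(* A word is represented by the pair (numer w, ninv w): it equals numer w * Z^-(ninv w),
   each inverse letter s^-1 being written as (compl s) * Z^-1. *)
Definition numer w : A := foldr (fun x a => (if x.2 then compl x.1 else gen x.1) * a) 1 w.
Definition ninv w := count (fun x => x.2) w.

Lemma numer_cat u v : numer (u ++ v) = numer u * numer v.
Proof. by elim: u => [|x u IH] /=; rewrite ?mul1g // IH mulgA. Qed.
Lemma numer_wp (u : seq S) : numer (wp u) = bc u.
Proof. by elim: u => [|s u IH] //=; rewrite IH -cls_cons. Qed.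
Lemma ninv_wp (u : seq S) : ninv (wp u) = 0.
Proof. by elim: u. Qed.

(** Equality of fractions after cross multiplication. For positive words the exponents vanish, which
    makes [phi] injective. *)
Lemma numer_eq w1 w2 : artin_eq m w1 w2 -> numer w1 * Z ^+ ninv w2 = numer w2 * Z ^+ ninv w1.
Proof.
elim=> [//|v1 v2 _ -> //|v1 v2 v3 _ h1 _ h2|u v [s b]|u v _ _ [s [t [st [-> ->]]]]].
- apply: (canrA mC m2 w0max (a := Z ^+ ninv v2)).
  rewrite -!mulgA -!expgnDr addnC expgnDr mulgA h1 -mulgA -expgnDr addnC expgnDr mulgA h2.
  by rewrite -!mulgA -!expgnDr addnC.
- rewrite !numer_cat /ninv !count_cat /=.
  have -> : (b + (~~ b + count (fun x => x.2) v) = 1 + count (fun x => x.2) v)%N by case: b.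
  rewrite addnCA add1n expgS.
  have -> : (if b then compl s else gen s) * ((if ~~ b then compl s else gen s) * numer v) = Z * numer v.
    by rewrite mulgA; case: b; rewrite /= ?gen_compl ?compl_gen.
  by rewrite -(ZA_central mC m2 w0max (numer v)) !mulgA.
rewrite !numer_cat /ninv !count_cat -!/(ninv _) -!wp_alt !numer_wp !ninv_wp.
by rewrite (bc_braid mC st) (mC t).
Qed.

Lemma phi_inj : injective phi.
Proof.
move=> a b /avP/numer_eq; rewrite !numer_wp !ninv_wp !mulg1 !qrepK //.
Qed.

Lemma phi_central x : x * phi Z = phi Z * x.
Proof.
suff hw w : av w * phi Z = phi Z * av w by rewrite -(qrepK x); apply: hw.
elim: w => [|[s b] w IH]; first by rewrite av0 mulg1 mul1g.
rewrite av_cons -mulgA IH !mulgA; congr (_ * _).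
have cg : av [:: (s, false)] * phi Z = phi Z * av [:: (s, false)].
  by rewrite -(phi_bc m [:: s]) -!phiM (ZA_central mC m2 w0max).
case: b => //; have e : av [:: (s, true)] = (av [:: (s, false)])^-1.
  by rewrite -av_inv.
by rewrite e; apply: (mulgI (av [:: (s, false)])); rewrite !mulgA mulgV mul1g cg mulgK.
Qed.

Lemma phi_centralX n x : x * phi (Z ^+ n) = phi (Z ^+ n) * x.
Proof.
rewrite phiX; elim: n => [|n IH]; first by rewrite mulg1 mul1g.
by rewrite expgS mulgA phi_central -mulgA IH mulgA.
Qed.

Definition rep w a N := av w * phi (Z ^+ N) = phi a.

Lemma rep_numer w : rep w (numer w) (ninv w).
Proof.
rewrite /rep; elim: w => [|[s b] w IH] /=; first by rewrite phi1 mulg1.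
rewrite av_cons phiM -IH -/(ninv w); case: b => /=.
  have -> : phi (compl s) = av [:: (s, true)] * phi Z.
    by rewrite -(gen_compl s) phiM mulgA phi_bc (av_letter m (s, true)) mul1g.
  by rewrite add1n expgS phiM -[RHS]mulgA (mulgA (phi Z) (av w)) -(phi_central (av w)) !mulgA.
by rewrite add0n phi_bc mulgA.
Qed.

Lemma repX w a N n : rep w a N -> rep w (a * Z ^+ n) (N + n).
Proof. by rewrite /rep expgnDr !phiM mulgA => ->. Qed.

Lemma rep_ex w N : ninv w <= N -> exists a, rep w a N.
Proof.
by move=> h; exists (numer w * Z ^+ (N - ninv w)); rewrite -{2}(subnKC h); apply/repX/rep_numer.
Qed.

Lemma rep_word a N : exists w, rep w a N.
Proof.
by exists (wA a ++ invw (wA (Z ^+ N))); rewrite /rep avM av_inv -!/(phi _) mulgVK.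
Qed.

Lemma suppA_all s a : suppA a \subset [set~ s] -> all (fun x => hat s x.1) (wA a).
Proof.
move=> /subsetP h; rewrite all_map; apply/allP => t ta /=.
by have := h t; rewrite !inE => /(_ ta).
Qed.

(** The denominator [Z] involves [s] and leaves the parabolic subgroup. Fractions are formed inside
    it instead, by completing a letter and a positive element to a common multiple over the other
    letters. *)
Lemma hat_fraction s (u : word S) : all (fun x => hat s x.1) u ->
  exists x y, [/\ suppA x \subset [set~ s], suppA y \subset [set~ s] & av u * phi y = phi x].
Proof.
have s1 : suppA (1 : A) \subset [set~ s] by rewrite (suppA1 m2) sub0set.
elim: u => [_|[t b] u IH /= /andP[ht /IH[x [y [hx hy e]]]]].
  by exists 1, 1; split=> //; rewrite av0 mul1g.
have st : suppA (gen t) \subset [set~ s] by rewrite (suppA_gen m2) sub1set !inE.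
rewrite av_cons; case: b.
  have [x' [y' [hx' hy' e']]] : cosetA [set~ s] (gen t) x.
    apply: (cosetA_trans mC m2 w0max (b := 1)).
      by exists 1, (gen t); split=> //; rewrite mul1g mulg1.
    by exists x, 1; split=> //; rewrite mul1g mulg1.
  exists x', (y * y'); split; [by []|by rewrite (suppAM m2) subUset hy|].
  rewrite -mulgA phiM (mulgA (av u)) e -phiM -e' phiM phi_bc mulgA.
  by rewrite (av_letter m (t, true)) mul1g.
exists (gen t * x), y; split=> //; first by rewrite (suppAM m2) subUset st.
by rewrite phiM phi_bc -mulgA e.
Qed.

Lemma in_coset_rep s h g a b N : rep h a N -> rep g b N ->
  in_coset m h (hat s) g <-> cosetA [set~ s] a b.
Proof.
rewrite /rep => eh eg; split=> [/in_cosetP[u /hat_fraction[x [y [hx hy e]]] e']|[x [y [hx hy e]]]].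
  exists x, y; split=> //; apply: phi_inj.
  rewrite !phiM -eh -eg -!mulgA -!phi_centralX !mulgA; congr (_ * _).
  by rewrite -e mulgA e'.
apply/in_cosetP; exists (wA x ++ invw (wA y)).
  rewrite all_cat suppA_all // /invw all_rev all_map.
  exact: (suppA_all hy).
rewrite avM av_inv -!/(phi _) mulgA; apply: (mulIg (phi y)); rewrite mulgVK.
apply: (mulIg (phi (Z ^+ N))); rewrite -!mulgA !phi_centralX !mulgA eh eg -!phiM.
by rewrite e.
Qed.
End Transfer.

(** * The longest element from finiteness, and the proof of the theorem *)

Lemma coxeter_eq_wv (S : finType) (m : S -> S -> nat) (w1 w2 : word S) :
  coxeter_eq m w1 w2 -> wv m [seq x.1 | x <- w1] = wv m [seq x.1 | x <- w2].
Proof.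
have fst_alt s t n : [seq x.1 | x <- alt s t n] = altw s t n.
  by rewrite /alt /altw /mkseq -map_comp; apply: eq_map => i.
elim=> [//|v1 v2 _ -> //|v1 v2 v3 _ -> _ -> //|u v [s b]|u v a b].
  rewrite !map_cat !wvM /= (wv_cons m s (_ :: _)) (wv_cons m s (map _ _)).
  by rewrite (mulgA (wv m [:: s])) wvss mul1g.
case=> [[s [t [st [-> ->]]]]|[s [-> ->]]]; rewrite !map_cat.
  by rewrite !wvM !fst_alt wv_braid.
rewrite /= !(wvM m (map _ u)) (wv_cons m s (_ :: _)) (wv_cons m s (map _ _)).
by rewrite (mulgA (wv m [:: s])) wvss mul1g.
Qed.

Lemma longest_ex (S : finType) (m : S -> S -> nat) :
  spherical m -> exists w0 : coxg m, forall w : coxg m, clen w <= clen w0.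
Proof.
case=> l hl; pose P n := `[< exists w : coxg m, clen w = n >].
have exP : exists n, P n by exists (clen (1 : coxg m)); apply/asboolP; exists 1.
have bound n : P n -> n <= \max_(w <- l) size w.
  case/asboolP => w <-; have [u _ eu] := reduced_ex w.
  have [w' wl /coxeter_eq_wv e] := hl (wp u).
  have -> : w = wv m [seq x.1 | x <- w'].
    by rewrite -e -eu /wp -map_comp map_id.
  apply: leq_trans (clen_le m _) _; rewrite size_map.
  exact: (@leq_bigmax_seq _ l xpredT size w' wl).
case: (ex_maxnP exP bound) => n /asboolP[w0 e] h; exists w0 => w.
by rewrite e; apply: h; apply/asboolP; exists w.
Qed.

Theorem theorem8p1 (S : finType) (m : S -> S -> nat) (p : seq S) :
  dynkin_matrix m -> spherical m -> irreducible m ->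
  linear_subgraph m p ->
  bowtie_free m p.
Proof.
case=> mC m2 /longest_ex[w0 w0max] _ [up lin] x1 x2 y1 y2 px1 px2 py1 py2 _ _ _ _ _ ny.
move=> [[g11 [h11 k11]] [_ [_ i11]]] [[g12 [h12 k12]] [_ [_ i12]]].
move=> [[g21 [h21 k21]] [_ [_ i21]]] [[g22 [h22 k22]] [_ [_ i22]]].
(* One exponent large enough for all eight words, so that cosets are compared over the same
   denominator. *)
pose N := (ninv x1.1 + ninv x2.1 + ninv y1.1 + ninv y2.1 + ninv g11 + ninv g12 + ninv g21 + ninv g22)%N.
have rx w : ninv w <= N -> exists a, rep w0 w a N by apply: rep_ex.
have [a1 ra1] : exists a, rep w0 x1.1 a N by apply: rx; rewrite /N; lia.
have [a2 ra2] : exists a, rep w0 x2.1 a N by apply: rx; rewrite /N; lia.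
have [b11 rb11] : exists a, rep w0 g11 a N by apply: rx; rewrite /N; lia.
have [b12 rb12] : exists a, rep w0 g12 a N by apply: rx; rewrite /N; lia.
have [b21 rb21] : exists a, rep w0 g21 a N by apply: rx; rewrite /N; lia.
have [b22 rb22] : exists a, rep w0 g22 a N by apply: rx; rewrite /N; lia.
have inc s h g a b M : rep w0 h a M -> rep w0 g b M ->
    in_coset m h (hat s) g <-> cosetA [set~ s] a b.
  exact: (in_coset_rep mC m2 w0max).
have rw a M : exists w, rep w0 w a M by apply: rep_word.
have h1 : cosetA [set~ x1.2] b11 a1 by apply/(inc _ _ _ _ _ _ rb11 ra1)/in_coset_sym.
have h2 : cosetA [set~ x1.2] b12 a1 by apply/(inc _ _ _ _ _ _ rb12 ra1)/in_coset_sym.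
have h3 : cosetA [set~ x2.2] b21 a2 by apply/(inc _ _ _ _ _ _ rb21 ra2)/in_coset_sym.
have h4 : cosetA [set~ x2.2] b22 a2 by apply/(inc _ _ _ _ _ _ rb22 ra2)/in_coset_sym.
have h5 : cosetA [set~ y1.2] b11 b21.
  by apply/(inc _ _ _ _ _ _ rb11 rb21); apply: in_coset_trans k21; apply: in_coset_sym.
have h6 : cosetA [set~ y2.2] b12 b22.
  by apply/(inc _ _ _ _ _ _ rb12 rb22); apply: in_coset_trans k22; apply: in_coset_sym.
have vx1y1 : vlt m p x1 y1 by split; [exists g11|].
have vx1y2 : vlt m p x1 y2 by split; [exists g12|].
have vx2y1 : vlt m p x2 y1 by split; [exists g21|].
have vx2y2 : vlt m p x2 y2 by split; [exists g22|].
case: (separatingA mC m2 w0max h1 h2 h3 h4 h5 h6) => [[e [M [e1 e2]]]|].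
  have [w rw'] := rw e (N + M).
  have yw1 : in_coset m y1.1 (hat y1.2) w.
    by apply: in_coset_trans k11 _; apply: in_coset_sym; apply/(inc _ _ _ _ _ _ rw' (repX M rb11)).
  have yw2 : in_coset m y2.1 (hat y2.2) w.
    by apply: in_coset_trans k12 _; apply: in_coset_sym; apply/(inc _ _ _ _ _ _ rw' (repX M rb12)).
  have yy : vadj m y1 y2 by exists w.
  have yy' : vadj m y2 y1 by exists w.
  have vr x : veq m x x by split.
  case: (ltngtP (index y1.2 p) (index y2.2 p)) => ii.
  - by exists y1; split=> //; split; [right|split; [right|split; [left|right]]].
  - by exists y2; split=> //; split; [right|split; [right|split; [right|left]]].
  (* Equal types and a common element would make the two vertices equal. *)
  case: ny; have e12 : y1.2 = y2.2 by rewrite -(nth_index y1.2 py1) ii nth_index.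
  apply: veqI => //; apply: in_coset_trans yw1 _; rewrite e12; exact: in_coset_sym.
case=> n [C [cC dC aC bC hC]].
set mi := minn (index y1.2 p) (index y2.2 p).
(* Positions before y1 and y2 whose letter is outside [C]. Those of x1 and x2 qualify, so the
   largest such position is not before either of them, as z above both requires. *)
pose P i := (i < mi) && (nth x1.2 p i \notin C).
have P1 : P (index x1.2 p) by rewrite /P nth_index // aC andbT /mi leq_min i11.
have P2 : P (index x2.2 p) by rewrite /P nth_index // bC andbT /mi leq_min i21.
have Pb i : P i -> i <= mi by case/andP => /ltnW.
case: (ex_maxnP (ex_intro P _ P1) Pb) => i /andP[imi kC] imax.
have lmi : mi < size p by rewrite /mi gtn_min !index_mem py1.
have ip : i < size p by apply: ltn_trans lmi.
set k := nth x1.2 p i in kC.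
have kp : k \in p by apply: mem_nth.
have ik : index k p = i by apply: index_uniq.
have [|q1 [e [M [q2 q3]]] [f1 r1 s1] [f2 r2 s2] [t1 t2]] := hC k kC.
  (* By maximality the next letter of the path is in [C], unless it is already the type of y1 or y2,
     which is in [C] too. *)
  exists (nth x1.2 p i.+1).
    case: (ltngtP i.+1 mi) => h; last 2 first.
    - by move: h; rewrite ltnNge imi.
    - by rewrite h /mi; case: leqP => _; rewrite nth_index.
    by apply/negPn/negP => nC; have := imax i.+1; rewrite /P h nC => /(_ isT); rewrite ltnn.
  have jp : i.+1 < size p by apply: leq_ltn_trans lmi.
  by rewrite lin // ?mem_nth // ik index_uniq // eqxx.
have [w rw'] := rw n N.
have zx x a f : x.2 \in p -> rep w0 x.1 a N -> P (index x.2 p) ->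
    cosetA [set~ k] f n -> cosetA [set~ x.2] f a -> (k = x.2 -> cosetA [set~ k] n a) ->
    vle m p x (w, k).
  move=> xp ra /imax xi c1 c2 c3; case: (eqVneq k x.2) => [ex|nx]; [left|right].
    apply: veqI => //=; rewrite -ex; apply: in_coset_sym.
    by apply/(inc _ _ _ _ _ _ rw' ra)/c3.
  split; last first.
    split=> //; split=> //=; rewrite ik ltn_neqAle xi andbT -ik.
    by apply: contra_neq nx => ei; rewrite -(nth_index k kp) -ei nth_index.
  have [v rv] := rw f N; exists v; split; apply: in_coset_sym.
    exact/(inc _ _ _ _ _ _ rv ra).
  exact/(inc _ _ _ _ _ _ rv rw').
exists (w, k); split=> //; split; first exact: (zx x1 a1 f1).
split; first exact: (zx x2 a2 f2).
split; right; (split; last by split=> //; split=> //=; rewrite ik; move: imi; rewrite /mi leq_min => /andP[]).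
  exists w; split; first exact: in_coset_refl.
  apply: in_coset_trans k11 _; apply: in_coset_sym; exact/(inc _ _ _ _ _ _ rw' rb11).
have [v rv] := rw e (N + M); exists v; split.
  by apply: in_coset_sym; apply/(inc _ _ _ _ _ _ rv (repX M rw')).
apply: in_coset_trans k12 _; apply: in_coset_sym; exact/(inc _ _ _ _ _ _ rv (repX M rb12)).
Qed.
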